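(* Fix $p\in[1,\infty)$ and $q_0,q_1,r_0,r_1\in[1,\infty]$ with $q_0\le q_1$, $q_0\le r_0$, $q_1\le r_1$. Let $\mathfrak X$ be an arbitrary metric measure space and assume $\mathcal M^{\rm c}_{\mathfrak X}$ is bounded from $L^{p,q_i}(\mathfrak X)$ to $L^{p,r_i}(\mathfrak X)$ for $i\in\{0,1\}$. Then for each $\theta\in(0,1)$, $\mathcal M^{\rm c}_{\mathfrak X}$ is bounded from $L^{p,q_\theta}(\mathfrak X)$ to $L^{p,r_\theta}(\mathfrak X)$, where $\frac1{q_\theta}=\frac{1-\theta}{q_0}+\frac\theta{q_1}$ and $\frac1{r_\theta}=\frac{1-\theta}{r_0}+\frac\theta{r_1}$ (with $1/\infty=0$).
   Context: Metric measure space $(X,\rho,\mu)$: nonempty set, metric, nonnegative Borel measure. $\mathcal M^{\rm c}_{\mathfrak X}f(x)=\sup_{s>0}\mu(B(x,s))^{-1}\int_{B(x,s)}|f|d\mu$ over open balls, balls of measure $0$ or $\infty$ omitted. Lorentz quasinorm: $d_f(t)=\mu(\{|f|>t\})$, $\|f\|_{p,q}=p^{1/q}(\int_0^\infty(t d_f(t)^{1/p})^q dt/t)^{1/q}$ for $q<\infty$, $\|f\|_{p,\infty}=\sup_{t>0}t d_f(t)^{1/p}$; $L^{p,q}(\mathfrak X)$ the corresponding space. *)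

(* Defs.v *)
From HB Require Import structures.
From mathcomp Require Import all_boot all_order all_algebra.
From mathcomp Require Import all_classical all_reals all_analysis.
Set Implicit Arguments. Unset Strict Implicit. Unset Printing Implicit Defensive.
Import Order.TTheory GRing.Theory Num.Theory.
Local Open Scope classical_set_scope.
Local Open Scope ring_scope.

Definition is_metric (R : realType) (T : Type) (rho : T -> T -> R) : Prop :=
  (forall x y, rho x y = 0 <-> x = y) /\
  (forall x y, rho x y = rho y x) /\
  (forall x y z, rho x z <= rho x y + rho y z).

Definition mball (R : realType) (T : Type) (rho : T -> T -> R) (x : T) (s : R) : set T :=
  [set y | rho x y < s].

Definition metric_open (R : realType) (T : Type) (rho : T -> T -> R) : set (set T) :=
  [set A | forall x, A x -> exists2 r : R, 0 < r & mball rho x r `<=` A].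

(* outer measure induced by mu (coincides with mu on measurable sets) *)
Definition outer_mu (d : measure_display) (T : measurableType d) (R : realType)
  (mu : set T -> \bar R) (A : set T) : \bar R :=
  ereal_inf [set mu B | B in [set B | measurable B /\ A `<=` B]].

Definition distf (d : measure_display) (T : measurableType d) (R : realType)
  (mu : set T -> \bar R) (g : T -> \bar R) (t : R) : \bar R :=
  outer_mu mu [set x | (t%:E < `|g x|)%E].

Definition lorentz_norm (d : measure_display) (T : measurableType d) (R : realType)
  (mu : set T -> \bar R) (p : R) (q : \bar R) (g : T -> \bar R) : \bar R :=
  match q with
  | r%:E => ((p `^ r^-1)%:E *
      (\int[lebesgue_measure]_(t in `]0%R, +oo[%classic)
          (((t%:E * (distf mu g t `^ p^-1)) `^ r) * (t^-1)%:E)) `^ r^-1)%E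
  | +oo%E => ereal_sup [set (t%:E * (distf mu g t `^ p^-1))%E | t in `]0%R, +oo[%classic]
  | -oo%E => 0%E
  end.

(* centered Hardy–Littlewood maximal function (sup over an empty family := 0) *)
Definition maxfun_c (d : measure_display) (T : measurableType d) (R : realType)
  (rho : T -> T -> R) (mu : set T -> \bar R) (f : T -> R) (x : T) : \bar R :=
  ereal_sup ([set 0%E] `|`
    [set ((fine (mu (mball rho x s)))^-1%:E * \int[mu]_(y in mball rho x s) `|(f y)%:E|)%E
      | s in [set s : R | 0 < s /\ (0 < mu (mball rho x s) < +oo)%E]]).

Definition maxfun_bounded (d : measure_display) (T : measurableType d) (R : realType)
  (rho : T -> T -> R) (mu : set T -> \bar R) (p : R) (q r : \bar R) : Prop :=
  exists C : R, forall f : T -> R, measurable_fun setT f ->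
    (lorentz_norm mu p q (fun x => (f x)%:E) < +oo)%E ->
    (lorentz_norm mu p r (maxfun_c rho mu f) <= C%:E * lorentz_norm mu p q (fun x => (f x)%:E))%E.

Definition einv (R : realType) (q : \bar R) : R :=
  match q with r%:E => r^-1 | _ => 0 end.

Definition from_inv (R : realType) (a : R) : \bar R :=
  if a == 0 then +oo%E else (a^-1)%:E.

Definition interp_exp (R : realType) (q0 q1 : \bar R) (theta : R) : \bar R :=
  from_inv ((1 - theta) * einv q0 + theta * einv q1).

(* Main.v *)
(* Idea. Put a_k(g) = 2^k d_g(2^k)^(1/p) for k in Z. Cutting (0, oo) at the powers
   of 2 shows that ||g||_{p,q} is equivalent to the l^q norm of a(g), and cutting f
   at a union of dyadic levels {2^k < |f| <= 2^(k+1)} truncates a(f) to these k, up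
   to a geometric tail. Since M is sublinear and d_(g+h)(2t) <= d_g(t) + d_h(t), the
   claim becomes a Marcinkiewicz interpolation for sequences, (l^q0 -> l^r0) and
   (l^q1 -> l^r1) implying (l^q -> l^r) when q0 < q1 and r0 < r1: split a at height
   2^m and compare b with 2^(eta m), where eta is chosen so that both halves sum to
   the l^q norm of a. If r1 <= r0 or q0 = q1, the embeddings l^s into l^t for s <= t
   already derive the claim from one of the two hypotheses. *)
Require Import Defs.
From HB Require Import structures.
From mathcomp Require Import all_boot all_order all_algebra.
From mathcomp Require Import all_classical all_reals all_analysis.
From mathcomp Require Import measurable_realfun.
From mathcomp Require Import zify ring lra.
Set Implicit Arguments. Unset Strict Implicit. Unset Printing Implicit Defensive.
Import Order.TTheory GRing.Theory Num.Theory.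
Local Open Scope classical_set_scope.
Local Open Scope ring_scope.

(** As p is the same on both sides, the second exponent only sees how a(f) is spread over the
    levels. Levels are therefore selected by the size of a_k, not by height; the selected set may
    have gaps, and these cause the tail. For a of l^q norm 1, the part cut at 2^m has l^qi norm at
    most 2^(m (1 - q/qi)); matching this with the threshold 2^(eta m) in the sum of r-th powers asks
    for eta (1 - r/ri) = 1 - q/qi, for i = 0 and i = 1. One eta solves both equations because 1/q
    and 1/r are averages of their endpoints with the same theta. The level sets of M f are seen
    through the outer measure, so the proof handles them by monotonicity and subadditivity alone.
    Dyadic values may a priori be infinite, so finiteness is secured before passing to real
    sequences. *)

(** * Nonnegative sums over arbitrary index sets, and geometric sums over the integers *)

Lemma esumZ (R : realType) (I : choiceType) (a : I -> \bar R) (c : R) :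
  0 <= c -> (forall i, 0 <= a i)%E ->
  (\esum_(i in [set: I]) (c%:E * a i) = c%:E * \esum_(i in [set: I]) a i)%E.
Proof.
have le_esumZ (c' : R) (b : I -> \bar R) : 0 <= c' -> (forall i, 0 <= b i)%E ->
    (\esum_(i in [set: I]) (c'%:E * b i) <= c'%:E * \esum_(i in [set: I]) b i)%E.
  move=> c0 b0; apply: ge_ereal_sup => _ [X [finX _] <-].
  rewrite -ge0_mule_fsumr//; apply: lee_wpmul2l; first by rewrite lee_fin.
  by apply: ereal_sup_ubound; exists X.
rewrite le_eqVlt => /predU1P[<- a0|c0 a0].
  by rewrite mul0e esum1// => i _; rewrite mul0e.
apply/eqP; rewrite eq_le; apply/andP; split.
  by apply: le_esumZ => //; exact: ltW.
rewrite -lee_pdivlMl//.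
(* The reverse inequality is the one already proved, for the factor 1/c and the terms c a_i. *)
have {1}-> : a = (fun i => c^-1%:E * (c%:E * a i))%E.
  by apply/funext => i; rewrite muleA -EFinM mulVf ?gt_eqF// mul1e.
apply: le_esumZ => [|i]; first by rewrite invr_ge0 ltW.
by rewrite mule_ge0// lee_fin ltW.
Qed.

Lemma esum_exchange (R : realType) (I J : choiceType) (a : I -> J -> \bar R) :
  (forall i j, 0 <= a i j)%E ->
  (\esum_(i in [set: I]) \esum_(j in [set: J]) a i j =
   \esum_(j in [set: J]) \esum_(i in [set: I]) a i j)%E.
Proof.
move=> a0; rewrite !esum_esum//.
rewrite (@reindex_esum _ _ _ ([set: J] `*`` (fun=> [set: I]))
  ([set: I] `*`` (fun=> [set: J])) (fun x => (x.2, x.1)))//.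
split=> [[]//|[i j] [i' j'] _ _ [-> ->]//|[i j] _].
by exists (j, i).
Qed.

Lemma esum_shift (R : realType) (a : int -> \bar R) (n : int) :
  (\esum_(k in [set: int]) a (k + n)%R = \esum_(k in [set: int]) a k)%E.
Proof.
rewrite [RHS](@reindex_esum _ _ _ [set: int] _ (fun k : int => k + n))//.
split=> [//|i j _ _ /addIr//|j _]; exists (j - n) => //; exact: subrK.
Qed.

Lemma esum_ge_term (R : realType) (I : choiceType) (a : I -> \bar R) (i : I) :
  (forall i, 0 <= a i)%E -> (a i <= \esum_(i in [set: I]) a i)%E.
Proof.
by move=> a0; apply: esum_ge; exists [set i]; [split|rewrite fsbig_set1].
Qed.

Lemma esum_geometric_le (R : realType) (rho : R) : 0 < rho < 1 ->
  (\esum_(n in [set: nat]) (rho ^+ n)%:E <= ((1 - rho)^-1)%:E)%E.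
Proof.
move=> /andP[rho0 rho1].
rewrite -nneseries_esumT; last by move=> n; rewrite lee_fin exprn_ge0// ltW.
apply: lime_le; first by apply: is_cvg_nneseries => n _ _; rewrite lee_fin exprn_ge0// ltW.
apply: nearW => n /=; rewrite sumEFin lee_fin.
have := @geometric_le_lim _ n 1 rho ler01 rho0.
rewrite (ger0_norm (ltW rho0)) => /(_ rho1); rewrite mul1r; apply: le_trans.
by rewrite /series/= le_eqVlt; apply/orP; left; apply/eqP/eq_bigr => i _;
  rewrite /geometric/= mul1r.
Qed.

Lemma esum_geometric_int_le (R : realType) (rho : R) (n : int) : 0 < rho < 1 ->
  (\esum_(m in [set: int]) (rho ^+ absz (m - n)%R)%:E <= (2 / (1 - rho))%:E)%E.
Proof.
move=> rho01; have /andP[rho0 rho1] := rho01.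
have r0 k : (0 <= (rho ^+ k)%:E)%E by rewrite lee_fin exprn_ge0// ltW.
rewrite (@esum_shift _ (fun m => (rho ^+ absz m)%:E) (- n)).
rewrite (esumID [set m : int | 0 <= m])//.
rewrite mulr2n mulrDl mul1r EFinD; apply: leeD.
  rewrite (@reindex_esum _ _ _ [set: nat] _ Posz).
    exact: esum_geometric_le.
  split=> [//|i j _ _ [->]//|[m|m] [_ H]]; by [exists m|].
(* [Negz k] has absolute value k + 1, so the negative half is a geometric series with a spare factor
   rho <= 1. *)
rewrite (@reindex_esum _ _ _ [set: nat] _ Negz).
  apply: le_trans (esum_geometric_le rho01); apply: le_esum => k _.
  by rewrite lee_fin ler_wiXn2l// ltW.
split=> [//|i j _ _ [->]//|[m|m] [_ H]]; by [exists m|case: H].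
Qed.

(** * Bounds in l^q for sequences indexed by the integers *)

Lemma ler_powR2r (R : realType) (r x y : R) : 0 < r -> 0 <= x -> 0 <= y ->
  (x `^ r <= y `^ r) = (x <= y).
Proof.
move=> r0 x0 y0; apply/idP/idP => [|xy]; last first.
  by apply: ge0_ler_powR => //; exact: ltW.
by apply: contraTT; rewrite -!ltNge => yx; apply: gt0_ltr_powR.
Qed.

Lemma powRVK (R : realType) (r x : R) : r != 0 -> 0 <= x ->
  (x `^ r^-1) `^ r = x.
Proof. by move=> r0 x0; rewrite -powRrM mulVf// powRr1. Qed.

(** Encodes a norm bound without forming the norm: N stays a real number while the sum is taken in
    the extended reals. *)
Definition lq_bounded (R : realType) (q : \bar R) (a : int -> R) (N : R) : Prop :=
  match q with
  | r%:E => (\esum_(k in [set: int]) (a k `^ r)%:E <= (N `^ r)%:E)%E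
  | +oo%E => forall k, a k <= N
  | -oo%E => True
  end.

Lemma lq_bounded_le (R : realType) (q : \bar R) (a b : int -> R) (N M : R) :
  (1 <= q)%E -> (forall k, 0 <= a k) -> (forall k, a k <= b k) -> 0 <= N <= M ->
  lq_bounded q b N -> lq_bounded q a M.
Proof.
move=> q1 a0 ab /andP[N0 NM]; case: q q1 => [r| |]//=; last first.
  by move=> _ bN k; apply: le_trans (ab k) _; apply: le_trans (bN k) NM.
rewrite lee_fin => r1 bN; have r0 : 0 < r by apply: lt_le_trans r1.
apply: (@le_trans _ _ (N `^ r)%:E).
  apply: le_trans bN; apply: le_esum => k _.
  by rewrite lee_fin ler_powR2r// (le_trans (a0 k)).
by rewrite lee_fin ler_powR2r// (le_trans N0).
Qed.

Lemma lq_bounded_sup (R : realType) (q : \bar R) (a : int -> R) (N : R) k :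
  (1 <= q)%E -> (forall k, 0 <= a k) -> 0 <= N ->
  lq_bounded q a N -> a k <= N.
Proof.
move=> q1 a0 N0; case: q q1 => [r| |]//=; rewrite lee_fin => r1 aN.
have r0 : 0 < r by apply: lt_le_trans r1.
rewrite -(ler_powR2r r0)// -lee_fin; apply: le_trans aN.
by apply: (esum_ge_term (a := fun k => (a k `^ r)%:E)) => i; rewrite lee_fin powR_ge0.
Qed.

(** Every a_k is at most N, hence a_k^r <= N^(r - q) a_k^q; summing gives the embedding of l^q into
    l^r with constant 1. *)
Lemma lq_bounded_exponent (R : realType) (q r : \bar R) (a : int -> R) (N : R) :
  (1 <= q)%E -> (q <= r)%E -> (forall k, 0 <= a k) -> 0 <= N ->
  lq_bounded q a N -> lq_bounded r a N.
Proof.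
move=> q1 qr a0 N0 aN; have aN' k := lq_bounded_sup k q1 a0 N0 aN.
case: r qr => [r| |]//=.
case: q q1 aN => [q| |]//=; rewrite !lee_fin => q1 aN qr.
have q0 : 0 < q by apply: lt_le_trans q1.
have r0 : 0 < r by apply: lt_le_trans qr.
have powE x : 0 <= x -> x `^ r = x `^ (r - q) * x `^ q.
  rewrite le_eqVlt => /predU1P[<-|x0].
    by rewrite (powR0 (lt0r_neq0 r0)) (powR0 (lt0r_neq0 q0)) mulr0.
  by rewrite -powRD ?subrK// gt_eqF//= implybT.
rewrite (powE N)// EFinM.
apply: (@le_trans _ _ (\esum_(k in [set: int]) ((N `^ (r - q))%:E * (a k `^ q)%:E))%E).
  apply: le_esum => k _; rewrite -EFinM lee_fin powE//.
  have rq0 : 0 <= r - q by rewrite subr_ge0.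
  apply: ler_wpM2r; first exact: powR_ge0.
  by apply: ge0_ler_powR; rewrite ?nnegrE.
rewrite esumZ ?powR_ge0//; last by move=> k; rewrite lee_fin powR_ge0.
by apply: lee_wpmul2l => //; rewrite lee_fin powR_ge0.
Qed.

Lemma lq_boundedZ (R : realType) (q : \bar R) (a : int -> R) (N c : R) :
  (1 <= q)%E -> (forall k, 0 <= a k) -> 0 <= N -> 0 <= c ->
  lq_bounded q a N -> lq_bounded q (fun k => c * a k) (c * N).
Proof.
move=> q1 a0 N0 c0; case: q q1 => [r| |]//=; last first.
  by move=> _ aN k; rewrite ler_wpM2l.
rewrite lee_fin => r1 aN; under eq_esum do rewrite powRM// EFinM.
rewrite powRM// EFinM esumZ ?powR_ge0//; last by move=> k; rewrite lee_fin powR_ge0.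
by apply: lee_wpmul2l => //; rewrite lee_fin powR_ge0.
Qed.

Lemma lq_bounded_shift (R : realType) (q : \bar R) (a : int -> R) (N : R) (n : int) :
  lq_bounded q a N -> lq_bounded q (fun k => a (k + n)) N.
Proof.
by case: q => [r| |]//= aN; rewrite (esum_shift (fun k => (a k `^ r)%:E)).
Qed.

(** This absorbs the geometric tail left by a truncation. The index k depends on j in no controlled
    way, possibly the same k for many j, so b_j^r is bounded by the sum over all k of 2^(-|j - k|)
    a_k^r. Summing over j first gives at most 4 for each k, and 4 <= 4^r. *)
Lemma lq_bounded_smear (R : realType) (q : \bar R) (a b : int -> R) (N : R) :
  (1 <= q)%E -> (forall k, 0 <= a k) -> (forall k, 0 <= b k) -> 0 <= N ->
  (forall j, exists k, b j <= 2^-1 ^+ absz (j - k)%R * a k) ->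
  lq_bounded q a N -> lq_bounded q b (4 * N).
Proof.
move=> q1 a0 b0 N0 ba; have half k : 0 <= (2^-1 : R) ^+ k by rewrite exprn_ge0.
case: q q1 => [r| |]//=; last first.
  move=> _ aN j; have [k bk] := ba j; apply: (le_trans bk).
  have := aN k; have := a0 k.
  have : (2^-1 : R) ^+ absz (j - k)%R <= 1 by rewrite exprn_ile1// invf_le1// ler1n.
  have := half (absz (j - k)%R); nra.
rewrite lee_fin => r1 aN; have r0 : 0 < r by apply: lt_le_trans r1.
have ar0 k : (0 <= (a k `^ r)%:E)%E by rewrite lee_fin powR_ge0.
pose w (j k : int) : \bar R := ((2^-1 ^+ absz (j - k)%R)%:E * (a k `^ r)%:E)%E.
have w0 j k : (0 <= w j k)%E by rewrite mule_ge0// lee_fin.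
apply: (@le_trans _ _ (\esum_(j in [set: int]) \esum_(k in [set: int]) w j k)%E).
  apply: le_esum => j _; have [k bk] := ba j.
  apply: le_trans (esum_ge_term k (w0 j)); rewrite /w -EFinM lee_fin.
  apply: (@le_trans _ _ ((2^-1 ^+ absz (j - k)%R * a k) `^ r)).
    by rewrite ler_powR2r// mulr_ge0.
  rewrite powRM// ler_wpM2r ?powR_ge0//.
  apply: ge1r_powR => //; rewrite exprn_gt0//= exprn_ile1//.
  by rewrite invf_le1// ler1n.
rewrite esum_exchange//.
apply: (@le_trans _ _ (\esum_(k in [set: int]) (4%:E * (a k `^ r)%:E))%E).
  apply: le_esum => k _; rewrite /w.
  under eq_esum do rewrite muleC.
  rewrite esumZ ?powR_ge0//.
  rewrite (muleC 4%:E); apply: lee_wpmul2l => //.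
  apply: le_trans (esum_geometric_int_le k (_ : 0 < (2^-1 : R) < 1)) _.
    by rewrite invr_gt0 ltr0n/= invf_lt1// ltr1n.
  by rewrite lee_fin ler_pdivrMr; lra.
rewrite esumZ// powRM//; apply: (@le_trans _ _ (4%:E * (N `^ r)%:E)%E).
  by apply: lee_wpmul2l.
rewrite -EFinM lee_fin ler_wpM2r ?powR_ge0//.
by apply: le1r_powR => //; rewrite ler1n.
Qed.

(** * Powers of 2 with real exponents *)

Lemma pow2_gt0 (R : realType) (x : R) : 0 < 2 `^ x :> R.
Proof. by apply: powR_gt0. Qed.

Lemma pow2_ge0 (R : realType) (x : R) : 0 <= 2 `^ x :> R.
Proof. exact: powR_ge0. Qed.

Lemma pow2D (R : realType) (x y : R) : 2 `^ (x + y) = 2 `^ x * 2 `^ y :> R.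
Proof. by rewrite powRD// pnatr_eq0 implybT. Qed.

Lemma ler_pow2 (R : realType) (x y : R) : (2 `^ x <= 2 `^ y :> R) = (x <= y).
Proof.
have ln2 : 0 < ln 2 :> R by rewrite ln_gt0// ltr1n.
by rewrite /powR pnatr_eq0/= ler_expR ler_pM2r.
Qed.

Lemma ltr_pow2 (R : realType) (x y : R) : (2 `^ x < 2 `^ y :> R) = (x < y).
Proof. by rewrite !ltNge ler_pow2. Qed.

Lemma pow2_surj (R : realType) (u : R) : 0 < u -> exists x : R, u = 2 `^ x.
Proof.
move=> u0; exists (ln u / ln 2).
have ln2 : 0 < ln 2 :> R by rewrite ln_gt0// ltr1n.
by rewrite /powR pnatr_eq0/= divfK ?gt_eqF// lnK// posrE.
Qed.

Lemma pow2_succ (R : realType) (k : int) :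
  2 `^ k%:~R = 2 * 2 `^ (k - 1)%:~R :> R.
Proof. by rewrite -[X in X * _](powRr1 (ler0n _ 2)) -pow2D intrB mulr1z addrC subrK. Qed.

Lemma pow2_level (R : realType) (eta u : R) : 0 < eta -> 0 < u ->
  exists m : int, 2 `^ (eta * m%:~R) < u <= 2 `^ (eta * m%:~R + eta).
Proof.
(* The witness is the ceiling of x / eta, minus 1: this makes the left inequality strict and the
   right one large. *)
move=> eta0 /pow2_surj[x ->]; exists (- Num.floor (- (x / eta)) - 1).
set n := Num.floor _; have xE : x = eta * (x / eta) by rewrite mulrCA divff ?mulr1// gt_eqF.
have n1 : n%:~R <= - (x / eta) by exact: floor_le.
have n2 : - (x / eta) < n%:~R + 1 by rewrite -[1]/(1%:~R) -intrD floorD1_gt.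
rewrite ltr_pow2 ler_pow2 xE; rewrite intrB intrN mulr1z.
by apply/andP; split; nra.
Qed.

(** * Marcinkiewicz interpolation for sequences *)

(** The second factor bounds a two-sided geometric sum of ratio 2^(-|e|); the first pays for
    rounding log_2 u down to an integer. *)
Definition geo_const (R : realType) (e : R) : R :=
  2 `^ `|e| * (2 / (1 - 2 `^ (- `|e|))).

Lemma geo_const_ge0 (R : realType) (e : R) : e != 0 -> 0 <= geo_const e.
Proof.
move=> e0; rewrite mulr_ge0 ?pow2_ge0// divr_ge0// subr_ge0.
by rewrite -[leRHS](powRr0 (2 : R)) ler_pow2 oppr_le0.
Qed.

(** With u = 2^x the condition reads (x - m) e >= 0: it keeps only the m on the side of x where 2^(m
    e) = u^e 2^(-|e| |x - m|) decays away from u^e. *)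
Lemma esum_pow2_le (R : realType) (e u : R) (P : int -> bool) : e != 0 -> 0 < u ->
  (forall m, P m -> (u / 2 `^ m%:~R) `^ e >= 1) ->
  (\esum_(m in [set: int]) (if P m then 2 `^ (m%:~R * e) else 0)%:E <=
    (geo_const e * u `^ e)%:E)%E.
Proof.
move=> e0 /pow2_surj[x ->] Pe; set n := Num.floor x.
have n1 : n%:~R <= x by exact: floor_le.
have n2 : x < n%:~R + 1 by rewrite -[1]/(1%:~R) -intrD floorD1_gt.
have ne0 : 0 < `|e| by rewrite normr_gt0.
pose rho : R := 2 `^ (- `|e|).
have rho01 : 0 < rho < 1.
  by rewrite pow2_gt0/= -[ltRHS](powRr0 (2 : R)) ltr_pow2 oppr_lt0.
have [rho0 rho1] := andP rho01.
apply: (@le_trans _ _ (\esum_(m in [set: int])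
    ((2 `^ (x * e) * 2 `^ `|e|)%:E * (rho ^+ absz (m - n)%R)%:E))%E).
  apply: le_esum => m _; rewrite -EFinM lee_fin; case: ifPn => [Pm|_]; last first.
    by rewrite !mulr_ge0 ?pow2_ge0// exprn_ge0// ltW.
  rewrite -(powR_mulrn _ (ltW rho0)) /rho -powRrM -!pow2D ler_pow2 natr_absz intr_norm intrB.
  have := Pe m Pm; rewrite -powRB ?pnatr_eq0 ?implybT//.
  rewrite -powRrM -[leLHS](powRr0 (2 : R)) ler_pow2 => xm.
  have {}xm : `|e| * `|x - m%:~R| <= (x - m%:~R) * e.
    by rewrite -normrM mulrC ger0_norm.
  have : `|m%:~R - n%:~R| <= `|x - m%:~R| + 1.
    apply: (@le_trans _ _ (`|m%:~R - x| + `|x - n%:~R|)); first exact: ler_distD.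
    by rewrite distrC lerD2l ger0_norm; lra.
  nra.
have c0 : 0 <= 2 `^ (x * e) * 2 `^ `|e| :> R by rewrite mulr_ge0// pow2_ge0.
rewrite esumZ//; last by move=> m; rewrite lee_fin exprn_ge0// ltW.
apply: (@le_trans _ _ ((2 `^ (x * e) * 2 `^ `|e|)%:E * (2 / (1 - rho))%:E)%E).
  by apply: lee_wpmul2l; rewrite ?lee_fin//; exact: esum_geometric_int_le.
by rewrite -EFinM lee_fin -powRrM /geo_const -/rho le_eqVlt; apply/orP; left; apply/eqP; ring.
Qed.

(* The truncated sum S of a_k^qi is at most 2^(m (qi - q)), and ri >= qi, so
   S^(ri / qi) <= 2^(m (qi - q) (ri / qi - 1)) S is linear in S; this allows the
   sums over m and k to be exchanged. The condition on [P m] covers both truncations: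
   a_k > 2^m when qi < q, and a_k <= 2^m when q < qi. *)
Lemma lq_piece_finite (R : realType) (qi ri q r eta C : R) (a : int -> R)
    (P : int -> int -> bool) (c : int -> int -> R) :
  1 <= qi -> qi <= ri -> 0 < q -> q != qi -> 0 < C ->
  eta * (1 - r / ri) = 1 - q / qi ->
  (forall k, 0 <= a k) -> lq_bounded q%:E a 1 ->
  (forall m k, 0 < a k -> P m k -> 1 <= (a k / 2 `^ m%:~R) `^ (q - qi)) ->
  (forall m j, 0 <= c m j) ->
  (forall m N, 0 <= N -> lq_bounded qi%:E (fun k => if P m k then a k else 0) N ->
     lq_bounded ri%:E (c m) (C * N)) ->
  exists T : int -> int -> R, [/\ (forall m j, 0 <= T m j),
    (forall m j, C * 2 `^ (eta * m%:~R) < c m j -> 2 `^ (eta * m%:~R * r) <= T m j) &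
    (\esum_(m in [set: int]) \esum_(j in [set: int]) (T m j)%:E
       <= (geo_const (q - qi))%:E)%E].
Proof.
move=> qi1 qiri q0 qqi C0 Heta a0 aq PE c0 cb.
have qi0 : 0 < qi by apply: lt_le_trans qi1.
have ri0 : 0 < ri by apply: lt_le_trans qiri.
have Ci0 : 0 <= C^-1 by rewrite invr_ge0 ltW.
have Heta' : eta * (r - ri) = - (ri * (qi - q) / qi).
  have -> : eta * (r - ri) = - (ri * (eta * (1 - r / ri))) by field; rewrite gt_eqF.
  by rewrite Heta; field; rewrite gt_eqF.
(* A Chebyshev weight: where c_mj / C exceeds 2^(eta m), its ri-th power exceeds 2^(eta m ri), and
   the prefactor turns this into 2^(eta m r). By [Heta'] the prefactor also cancels the power of 2^m
   that linearizing S^(ri / qi) produces, up to 2^(m (q - qi)). *)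
exists (fun m j => 2 `^ (eta * m%:~R * (r - ri)) * (C^-1 * c m j) `^ ri); split.
- by move=> m j; rewrite mulr_ge0 ?pow2_ge0 ?powR_ge0.
- move=> m j cm; have -> : eta * m%:~R * r = eta * m%:~R * (r - ri) + eta * m%:~R * ri.
    by rewrite -mulrDr subrK.
  rewrite pow2D ler_wpM2l ?pow2_ge0// powRrM ler_powR2r ?pow2_ge0//.
    by rewrite ler_pdivlMl// ltW.
  by rewrite mulr_ge0// invr_ge0 ltW.
pose g m k : R := if P m k then a k `^ qi else 0.
have g0 m k : 0 <= g m k by rewrite /g; case: ifP => // _; exact: powR_ge0.
have inner m : (\esum_(j in [set: int])
    (2 `^ (eta * m%:~R * (r - ri)) * (C^-1 * c m j) `^ ri)%:E <=
    \esum_(k in [set: int]) (2 `^ (m%:~R * (q - qi)) * g m k)%:E)%E.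
  have gle k : g m k <= 2 `^ (m%:~R * (qi - q)) * a k `^ q.
    rewrite /g; case: ifPn => [Pmk|_]; last by rewrite mulr_ge0 ?powR_ge0.
    have [ak0|ak0] := eqVneq (a k) 0; first by rewrite ak0 !powR0 ?gt_eqF// mulr0.
    have ak : 0 < a k by rewrite lt0r ak0 a0.
    have := PE m k ak Pmk; have [x ->] := pow2_surj ak.
    rewrite -powRB ?pnatr_eq0 ?implybT// -!powRrM -pow2D -[leLHS](powRr0 (2 : R)) !ler_pow2.
    nra.
  have Sfin : (\esum_(k in [set: int]) (g m k)%:E <= (2 `^ (m%:~R * (qi - q)))%:E)%E.
    apply: (@le_trans _ _ (\esum_(k in [set: int])
        ((2 `^ (m%:~R * (qi - q)))%:E * (a k `^ q)%:E))%E).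
      by apply: le_esum => k _; rewrite -EFinM lee_fin.
    rewrite esumZ ?pow2_ge0//; last by move=> k; rewrite lee_fin powR_ge0.
    rewrite -[leRHS]mule1; apply: lee_wpmul2l; first by rewrite lee_fin pow2_ge0.
    by move: aq; rewrite /= powR1.
  have S0 : (0 <= \esum_(k in [set: int]) (g m k)%:E)%E.
    by apply: esum_ge0 => k _; rewrite lee_fin.
  under [leRHS]eq_esum do rewrite EFinM.
  rewrite [leRHS]esumZ ?pow2_ge0//; last by move=> k; rewrite lee_fin.
  move: Sfin S0; case E : (\esum_(k in [set: int]) (g m k)%:E)%E => [s| |]//.
  rewrite !lee_fin => sle s0.
  (* Here s is the sum of the qi-th powers of the truncated sequence, so its root is the smallest
     admissible N. *)
  have := cb m (s `^ qi^-1) (powR_ge0 _ _).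
  rewrite /= powRVK ?gt_eqF// => /(_ _)/wrap[].
    rewrite -E; apply: le_esum => k _; rewrite lee_fin /g.
    by case: ifP => // _; rewrite powR0// gt_eqF.
  move=> cm; under eq_esum do rewrite powRM// mulrA EFinM.
  rewrite esumZ; last 2 first.
  - by rewrite mulr_ge0 ?pow2_ge0 ?powR_ge0.
  - by move=> k; rewrite lee_fin powR_ge0.
  apply: (@le_trans _ _ ((2 `^ (eta * m%:~R * (r - ri)) * C^-1 `^ ri)%:E *
     ((C * s `^ qi^-1) `^ ri)%:E)%E).
    by apply: lee_wpmul2l => //; rewrite lee_fin mulr_ge0 ?pow2_ge0 ?powR_ge0.
  rewrite -!EFinM lee_fin -(mulrA (2 `^ _)) -powRM// ?mulr_ge0 ?powR_ge0 ?(ltW C0)//.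
  rewrite mulKf ?gt_eqF// -powRrM.
  move: s0; rewrite le_eqVlt => /predU1P[<-|s0].
    by rewrite powR0 ?mulr0// mulf_neq0// ?invr_eq0 gt_eqF.
  have [x xE] := pow2_surj s0; move: sle.
  rewrite xE -powRrM -!pow2D !ler_pow2 => sle.
  have -> : eta * m%:~R * (r - ri) = m%:~R * (eta * (r - ri)) by ring.
  rewrite Heta'.
  have ge1 : 0 <= ri / qi - 1 by rewrite subr_ge0 ler_pdivlMr// mul1r.
  have -> : m%:~R * - (ri * (qi - q) / qi) = - (m%:~R * (qi - q)) * (ri / qi).
    by field; rewrite gt_eqF.
  have -> : x * (qi^-1 * ri) = x * (ri / qi) by ring.
  nra.
apply: le_trans (le_esum (fun m _ => inner m)) _.
(* For fixed k, the sum over the m allowed by [P] is geometric, of order a_k^(q - qi); times a_k^qi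
   this is a_k^q, which is summable over k. *)
rewrite esum_exchange; last by move=> m k; rewrite lee_fin mulr_ge0 ?pow2_ge0.
apply: (@le_trans _ _ (\esum_(k in [set: int]) ((geo_const (q - qi))%:E * (a k `^ q)%:E))%E).
  apply: le_esum => k _.
  have [ak0|ak0] := eqVneq (a k) 0.
    rewrite esum1 ?mule_ge0// ?lee_fin ?geo_const_ge0 ?powR_ge0 ?subr_eq0//.
    by move=> m _; rewrite /g ak0 powR0 ?if_same ?mulr0// gt_eqF.
  have ak : 0 < a k by rewrite lt0r ak0 a0.
  apply: (@le_trans _ _ (\esum_(m in [set: int]) ((a k `^ qi)%:E *
       (if P m k then 2 `^ (m%:~R * (q - qi)) else 0)%:E))%E).
    apply: le_esum => m _; rewrite -EFinM lee_fin /g.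
    by case: ifP => _; rewrite ?mulr0// mulrC.
  rewrite esumZ ?powR_ge0//; last first.
    by move=> m; rewrite lee_fin; case: ifP => // _; exact: pow2_ge0.
  have qqi' : q - qi != 0 by rewrite subr_eq0.
  have H := @esum_pow2_le R (q - qi) (a k) (fun m => P m k) qqi' ak (fun m => PE m k ak).
  apply: le_trans (lee_wpmul2l _ H) _; first by rewrite lee_fin powR_ge0.
  rewrite -!EFinM lee_fin mulrCA -powRD ?(gt_eqF ak) ?implybT//.
  by rewrite [qi + _]addrC subrK.
rewrite esumZ; last 2 first.
- by rewrite geo_const_ge0// subr_eq0.
- by move=> k; rewrite lee_fin powR_ge0.
rewrite -[leRHS]mule1; apply: lee_wpmul2l; first by rewrite lee_fin geo_const_ge0 ?subr_eq0.
by move: aq; rewrite /= powR1.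
Qed.

(** The part of a below 2^m has l^qi norm at most 2^(m (1 - q/qi)) = 2^(eta m), whether qi is finite
    or not. With target l^oo the threshold is thus never exceeded and no summation is required. *)
Lemma lq_piece_infinite (R : realType) (qi : \bar R) (q eta C : R) (a : int -> R)
    (c : int -> int -> R) :
  (1 <= qi)%E -> 0 < q -> (q%:E < qi)%E ->
  eta = 1 - q * einv qi -> 0 < C ->
  (forall k, 0 <= a k) -> lq_bounded q%:E a 1 ->
  (forall m N, 0 <= N ->
     lq_bounded qi (fun k => if 2 `^ m%:~R < a k then 0 else a k) N ->
     lq_bounded +oo%E (c m) (C * N)) ->
  forall m j, c m j <= C * 2 `^ (eta * m%:~R).
Proof.
move=> qi1 q0 qqi -> C0 a0 aq cb m j.
apply: cb; first exact: pow2_ge0.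
case: qi qi1 qqi => [qi| |]//=; last first.
  by move=> _ _ k; rewrite mulr0 subr0 mul1r; case: ltP => // _; exact: pow2_ge0.
rewrite lee_fin lte_fin => qi1 qqi; have qi0 : 0 < qi by apply: lt_le_trans qi1.
apply: (@le_trans _ _ (\esum_(k in [set: int])
    ((2 `^ (m%:~R * (qi - q)))%:E * (a k `^ q)%:E))%E).
  apply: le_esum => k _; rewrite -EFinM lee_fin.
  case: ltP => [_|akm]; first by rewrite powR0 ?gt_eqF// mulr_ge0 ?powR_ge0.
  have [ak0|ak0] := eqVneq (a k) 0.
    by rewrite ak0 powR0 ?gt_eqF// mulr_ge0 ?powR_ge0.
  have ak : 0 < a k by rewrite lt0r ak0 a0.
  move: akm; have [x ->] := pow2_surj ak.
  by rewrite -!powRrM -pow2D !ler_pow2 => xm; nra.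
rewrite esumZ ?pow2_ge0//; last by move=> k; rewrite lee_fin powR_ge0.
rewrite -powRrM.
have -> : (1 - q / qi) * m%:~R * qi = m%:~R * (qi - q) by field; rewrite gt_eqF.
rewrite -[leRHS]mule1; apply: lee_wpmul2l; first by rewrite lee_fin pow2_ge0.
by move: aq; rewrite /= powR1.
Qed.

Lemma lq_piece_upper (R : realType) (qi ri : \bar R) (q r eta C : R) (a : int -> R)
    (c : int -> int -> R) :
  (1 <= qi)%E -> (qi <= ri)%E -> 0 < q -> (q%:E < qi)%E -> 0 < C ->
  eta * (1 - r * einv ri) = 1 - q * einv qi ->
  (forall k, 0 <= a k) -> lq_bounded q%:E a 1 ->
  (forall m j, 0 <= c m j) ->
  (forall m N, 0 <= N ->
     lq_bounded qi (fun k => if 2 `^ m%:~R < a k then 0 else a k) N ->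
     lq_bounded ri (c m) (C * N)) ->
  exists T : int -> int -> R, [/\ (forall m j, 0 <= T m j),
    (forall m j, C * 2 `^ (eta * m%:~R) < c m j -> 2 `^ (eta * m%:~R * r) <= T m j) &
    (\esum_(m in [set: int]) \esum_(j in [set: int]) (T m j)%:E
       <= (geo_const (q - fine qi))%:E)%E].
Proof.
move=> qi1 qiri q0 qqi C0 Heta a0 aq c0 cb.
case: ri qiri Heta cb => [ri| |]; last by case: (qi) qi1.
  case: qi qi1 qqi => [qi| |]//=; rewrite !lee_fin lte_fin => qi1 qqi qiri Heta cb.
  apply: (@lq_piece_finite _ _ ri _ r eta C a (fun m k => ~~ (2 `^ m%:~R < a k)) c) => //.
  - by rewrite lt_eqF.
  - move=> m k ak; rewrite -leNgt; have [x ->] := pow2_surj ak; rewrite ler_pow2 => xm.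
    rewrite -powRB ?pnatr_eq0 ?implybT// -powRrM -[leLHS](powRr0 (2 : R)) ler_pow2; nra.
  move=> m N N0 aN; apply: cb => //; move: aN => /=.
  by under eq_esum do rewrite if_neg.
move=> _; rewrite mulr0 subr0 mulr1 => Heta cb.
have cle := lq_piece_infinite qi1 q0 qqi Heta C0 a0 aq cb.
(* No entry passes the threshold, so the zero weight does. If qi is infinite, [fine qi] is 0, and
   the claimed bound is still nonnegative because q > 0. *)
exists (fun _ _ => 0); split=> // [m j|]; first by rewrite ltNge cle.
rewrite esum1 => [|m _]; last by rewrite esum1.
rewrite lee_fin geo_const_ge0//.
by move: qi1 qqi; case: (qi) => [qi'| |]//=; rewrite ?lte_fin => _ h; lra.
Qed.

(** C is doubled because b is a sum of two parts; 2^(eta r) is the loss from rounding b_j / (2 C) to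
    a power of 2^eta; the bracket collects the geometric sums of the two parts. *)
Definition marcinkiewicz_const (R : realType) (q0 : R) (q1 : \bar R) (q r eta C : R) : R :=
  ((2 * C) `^ r * 2 `^ (eta * r) * (geo_const (q - q0) + geo_const (q - fine q1))) `^ r^-1.

(** Each b_j is examined at the height m adapted to its own size, so the decompositions at all
    heights 2^m are fixed beforehand. One term of the sum over m already dominates b_j^r, and the
    sums of the weights over all m and j converge. *)
Lemma lq_marcinkiewicz_unit (R : realType) (q0 r0 q r eta C : R) (q1 r1 : \bar R)
    (a b : int -> R) :
  1 <= q0 -> q0 <= r0 -> q0 < q -> (q%:E < q1)%E -> (q1 <= r1)%E ->
  0 < r -> 0 < eta -> 0 < C ->
  eta * (1 - r / r0) = 1 - q / q0 ->
  eta * (1 - r * einv r1) = 1 - q * einv q1 ->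
  (forall k, 0 <= a k) -> (forall k, 0 <= b k) -> lq_bounded q%:E a 1 ->
  (forall s, 0 < s -> exists b0 b1, [/\ (forall j, 0 <= b0 j), (forall j, 0 <= b1 j),
     (forall j, b j <= b0 j + b1 j),
     (forall N, 0 <= N -> lq_bounded q0%:E (fun k => if s < a k then a k else 0) N ->
        lq_bounded r0%:E b0 (C * N)) &
     (forall N, 0 <= N -> lq_bounded q1 (fun k => if s < a k then 0 else a k) N ->
        lq_bounded r1 b1 (C * N))]) ->
  lq_bounded r%:E b (marcinkiewicz_const q0 q1 q r eta C).
Proof.
move=> q01 q0r0 q0q qq1 q1r1 rgt0 eta0 C0 Heta0 Heta1 a0 bge0 aq dec.
have q_gt0 : 0 < q by apply: lt_trans q0q; apply: lt_le_trans q01.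
have q11 : (1 <= q1)%E by apply: le_trans (ltW qq1); rewrite lee_fin (le_trans q01)// ltW.
have /choice[c0 /choice[c1 cP]] : forall m : int, exists b0 b1,
    [/\ (forall j, 0 <= b0 j), (forall j, 0 <= b1 j), (forall j, b j <= b0 j + b1 j),
     (forall N, 0 <= N -> lq_bounded q0%:E (fun k => if 2 `^ m%:~R < a k then a k else 0) N ->
        lq_bounded r0%:E b0 (C * N)) &
     (forall N, 0 <= N -> lq_bounded q1 (fun k => if 2 `^ m%:~R < a k then 0 else a k) N ->
        lq_bounded r1 b1 (C * N))].
  by move=> m; apply: dec; exact: pow2_gt0.
have [T0 [T00 T0P T0S]] : exists T : int -> int -> R, [/\ (forall m j, 0 <= T m j),
    (forall m j, C * 2 `^ (eta * m%:~R) < c0 m j -> 2 `^ (eta * m%:~R * r) <= T m j) &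
    (\esum_(m in [set: int]) \esum_(j in [set: int]) (T m j)%:E
       <= (geo_const (q - q0))%:E)%E].
  apply: (@lq_piece_finite _ _ r0 _ r eta C a (fun m k => 2 `^ m%:~R < a k) c0) => //.
  - by rewrite gt_eqF.
  - move=> m k ak; have [x ->] := pow2_surj ak; rewrite ltr_pow2 => xm.
    rewrite -powRB ?pnatr_eq0 ?implybT// -powRrM -[leLHS](powRr0 (2 : R)) ler_pow2; nra.
  - by move=> m j; have [] := cP m.
  - by move=> m; have [] := cP m.
have [T1 [T10 T1P T1S]] : exists T : int -> int -> R, [/\ (forall m j, 0 <= T m j),
    (forall m j, C * 2 `^ (eta * m%:~R) < c1 m j -> 2 `^ (eta * m%:~R * r) <= T m j) &
    (\esum_(m in [set: int]) \esum_(j in [set: int]) (T m j)%:E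
       <= (geo_const (q - fine q1))%:E)%E].
  apply: (@lq_piece_upper _ _ r1 _ r eta C a c1) => //.
  - by move=> m j; have [] := cP m.
  - by move=> m; have [] := cP m.
have g0 : 0 <= geo_const (q - q0) by rewrite geo_const_ge0// subr_eq0 gt_eqF.
have g1 : 0 <= geo_const (q - fine q1).
  by rewrite -lee_fin (le_trans _ T1S)//; do 2 (apply: esum_ge0 => ? _); rewrite lee_fin.
pose K := (2 * C) `^ r * 2 `^ (eta * r); have K0 : 0 <= K by rewrite mulr_ge0 ?powR_ge0.
rewrite /= powRVK ?gt_eqF//; last by rewrite mulr_ge0// addr_ge0.
have T01 m j : (0 <= (T0 m j + T1 m j)%:E)%E by rewrite lee_fin addr_ge0.
apply: (@le_trans _ _ (\esum_(j in [set: int]) \esum_(m in [set: int])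
    (K%:E * (T0 m j + T1 m j)%:E))%E).
  apply: le_esum => j _.
  have KT m : (0 <= K%:E * (T0 m j + T1 m j)%:E)%E by rewrite mule_ge0.
  have [bj0|bj0] := eqVneq (b j) 0.
    by rewrite bj0 powR0 ?gt_eqF//; apply: esum_ge0.
  have bj : 0 < b j by rewrite lt0r bj0 bge0.
  have [m /andP[mlt mle]] := pow2_level eta0 (divr_gt0 bj (mulr_gt0 (ltr0n R 2) C0)).
  apply: le_trans (esum_ge_term m KT); rewrite -EFinM lee_fin.
  apply: (@le_trans _ _ (K * 2 `^ (eta * m%:~R * r))).
    rewrite ler_pdivrMr ?mulr_gt0// in mle.
    apply: (@le_trans _ _ ((2 `^ (eta * m%:~R + eta) * (2 * C)) `^ r)).
      by rewrite ler_powR2r ?mulr_ge0 ?pow2_ge0 ?(ltW C0).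
    rewrite powRM ?pow2_ge0// ?mulr_ge0 ?(ltW C0)// -powRrM mulrDl pow2D /K.
    by rewrite le_eqVlt; apply/orP; left; apply/eqP; ring.
  apply: ler_wpM2l => //.
  rewrite ltr_pdivlMr ?mulr_gt0// in mlt.
  have [_ _ /(_ j) bjle _ _] := cP m.
  (* b_j exceeds 2 C 2^(eta m), so one of its two parts exceeds C 2^(eta m). *)
  have [c0big|c0small] := ltP (C * 2 `^ (eta * m%:~R)) (c0 m j).
    by apply: le_trans (T0P _ _ c0big) _; rewrite lerDl.
  have c1big : C * 2 `^ (eta * m%:~R) < c1 m j by lra.
  by apply: le_trans (T1P _ _ c1big) _; rewrite lerDr.
rewrite esum_exchange; last by move=> j m; rewrite mule_ge0.
under eq_esum do rewrite esumZ//.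
rewrite esumZ//; last by move=> m; exact: esum_ge0.
rewrite -/K [(K * _)%:E]EFinM; apply: lee_wpmul2l; first by rewrite lee_fin.
under eq_esum => m _.
  under eq_esum => j _ do rewrite EFinD.
  rewrite esumD; [over|by move=> *; rewrite lee_fin|by move=> *; rewrite lee_fin].
rewrite EFinD esumD; [exact: leeD| |].
- by move=> m _; apply: esum_ge0 => j _; rewrite lee_fin.
- by move=> m _; apply: esum_ge0 => j _; rewrite lee_fin.
Qed.

Lemma marcinkiewicz_const_ge0 (R : realType) (q0 : R) (q1 : \bar R) (q r eta C : R) :
  0 <= marcinkiewicz_const q0 q1 q r eta C.
Proof. exact: powR_ge0. Qed.

(** By homogeneity: a and b are divided by N, and cutting a / N at s amounts to cutting a at N s. *)
Lemma lq_marcinkiewicz (R : realType) (q0 r0 q r eta C N : R) (q1 r1 : \bar R)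
    (a b : int -> R) :
  1 <= q0 -> q0 <= r0 -> q0 < q -> (q%:E < q1)%E -> (q1 <= r1)%E ->
  1 <= r -> 0 < eta -> 0 < C -> 0 < N ->
  eta * (1 - r / r0) = 1 - q / q0 ->
  eta * (1 - r * einv r1) = 1 - q * einv q1 ->
  (forall k, 0 <= a k) -> (forall k, 0 <= b k) -> lq_bounded q%:E a N ->
  (forall s, 0 < s -> exists b0 b1, [/\ (forall j, 0 <= b0 j), (forall j, 0 <= b1 j),
     (forall j, b j <= b0 j + b1 j),
     (forall M, 0 <= M -> lq_bounded q0%:E (fun k => if s < a k then a k else 0) M ->
        lq_bounded r0%:E b0 (C * M)) &
     (forall M, 0 <= M -> lq_bounded q1 (fun k => if s < a k then 0 else a k) M ->
        lq_bounded r1 b1 (C * M))]) ->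
  lq_bounded r%:E b (N * marcinkiewicz_const q0 q1 q r eta C).
Proof.
move=> q01 q0r0 q0q qq1 q1r1 r_ge1 eta0 C0 N0 Heta0 Heta1 a0 b0 aq dec.
have q11 : (1 <= q1)%E by apply: le_trans (ltW qq1); rewrite lee_fin (le_trans q01)// ltW.
have Ni0 : 0 <= N^-1 by rewrite invr_ge0 ltW.
have NK (c : int -> R) : c = (fun k => N * (N^-1 * c k)).
  by apply/funext => k; rewrite mulVKf ?gt_eqF.
rewrite [b]NK; apply: lq_boundedZ => [|k|//||].
- by rewrite lee_fin.
- exact: mulr_ge0.
- exact: marcinkiewicz_const_ge0.
- exact: ltW.
have Ka0 k : 0 <= N^-1 * a k by exact: mulr_ge0.
apply: (@lq_marcinkiewicz_unit _ q0 r0 q r eta C q1 r1 (fun k => N^-1 * a k)) => //.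
- exact: lt_le_trans r_ge1.
- by move=> k; exact: mulr_ge0.
- have -> : 1 = N^-1 * N by rewrite mulVf ?gt_eqF.
  by apply: lq_boundedZ => //; [rewrite lee_fin (le_trans q01)// ltW|exact: ltW].
move=> s s0; have [c0 [c1 [c00 c10 bc c0q c1q]]] := dec (N * s) (mulr_gt0 N0 s0).
have thr k : (s < N^-1 * a k) = (N * s < a k) by rewrite ltr_pdivlMl.
have CE M : C * M = N^-1 * (C * (N * M)) by field; rewrite gt_eqF.
exists (fun j => N^-1 * c0 j), (fun j => N^-1 * c1 j); split.
- by move=> j; exact: mulr_ge0.
- by move=> j; exact: mulr_ge0.
- by move=> j; rewrite -mulrDr ler_wpM2l.
- move=> M M0 aM; have NM0 : 0 <= N * M by rewrite mulr_ge0// ltW.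
  rewrite CE; apply: lq_boundedZ => //.
  + by rewrite lee_fin (le_trans q01).
  + by rewrite mulr_ge0// ltW.
  apply: c0q => //; move/(lq_boundedZ _ _ M0 (ltW N0)) : aM; rewrite lee_fin => /(_ q01).
  move=> /(_ _)/wrap[k|]; first by case: ifP.
  congr (lq_bounded _ _ _); apply/funext => k; rewrite thr; case: ifP => _.
    by rewrite mulVKf ?gt_eqF.
  by rewrite mulr0.
- move=> M M0 aM; have NM0 : 0 <= N * M by rewrite mulr_ge0// ltW.
  rewrite CE; apply: lq_boundedZ => //.
  + exact: le_trans q1r1.
  + by rewrite mulr_ge0// ltW.
  apply: c1q => //; move/(lq_boundedZ q11 _ M0 (ltW N0)) : aM.
  move=> /(_ _)/wrap[k|]; first by case: ifP.
  congr (lq_bounded _ _ _); apply/funext => k; rewrite thr; case: ifP => _.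
    by rewrite mulr0.
  by rewrite mulVKf ?gt_eqF.
Qed.

(** Provides some finite bound for a truncated sequence, from a^qi = a^(qi - q) a^q and a^(qi - q)
    <= s^(qi - q). The last hypothesis fits both a_k > s with qi < q and a_k <= s with q < qi. *)
Lemma lq_bounded_trunc (R : realType) (q : R) (qi : \bar R) (s N : R) (a : int -> R)
    (P : int -> bool) :
  0 < q -> (1 <= qi)%E -> 0 <= s -> 0 <= N -> (forall k, 0 <= a k) ->
  lq_bounded q%:E a N -> (qi = +oo%E -> forall k, P k -> a k <= s) ->
  (forall k x, qi = x%:E -> 0 < a k -> P k -> a k `^ (x - q) <= s `^ (x - q)) ->
  exists2 M, 0 <= M & lq_bounded qi (fun k => if P k then a k else 0) M.
Proof.
move=> q0 qi1 s0 N0 a0 aN Ps Pq; case: qi qi1 Ps Pq => [qi| |]// qi1 Ps Pq; last first.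
  by exists s => //= k; case: ifPn => // /(Ps erefl).
rewrite lee_fin in qi1; have qi0 : 0 < qi by apply: lt_le_trans qi1.
exists ((s `^ (qi - q) * N `^ q) `^ qi^-1); first exact: powR_ge0.
rewrite /= powRVK ?gt_eqF//; last by rewrite mulr_ge0 ?powR_ge0.
apply: (@le_trans _ _ (\esum_(k in [set: int]) ((s `^ (qi - q))%:E * (a k `^ q)%:E))%E).
  apply: le_esum => k _; rewrite -EFinM lee_fin.
  case: ifPn => [Pk|_]; last by rewrite powR0 ?gt_eqF// mulr_ge0 ?powR_ge0.
  have [ak0|ak0] := eqVneq (a k) 0.
    by rewrite ak0 powR0 ?gt_eqF// mulr_ge0 ?powR_ge0.
  have ak : 0 < a k by rewrite lt0r ak0 a0.
  have -> : a k `^ qi = a k `^ (qi - q) * a k `^ q.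
    by rewrite -powRD ?subrK// ak0 implybT.
  by rewrite ler_wpM2r ?powR_ge0// (Pq k qi).
rewrite esumZ ?powR_ge0//; last by move=> k; rewrite lee_fin powR_ge0.
by rewrite EFinM; apply: lee_wpmul2l => //; rewrite lee_fin powR_ge0.
Qed.

(** * Outer measure, distribution functions and dyadic sequences *)

Lemma outer_mu_ge0 (R : realType) (d : measure_display) (T : measurableType d)
    (mu : {measure set T -> \bar R}) (A : set T) : (0 <= outer_mu mu A)%E.
Proof. by apply: le_ereal_inf_tmp => _ [B _ <-]. Qed.

Lemma outer_mu_le (R : realType) (d : measure_display) (T : measurableType d)
    (mu : {measure set T -> \bar R}) (A B : set T) :
  A `<=` B -> (outer_mu mu A <= outer_mu mu B)%E.
Proof.
move=> AB; apply: le_ereal_inf_tmp => _ [D [mD BD] <-].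
by apply: ereal_inf_lbound; exists D => //; split=> //; exact: subset_trans BD.
Qed.

Lemma outer_mu0 (R : realType) (d : measure_display) (T : measurableType d)
    (mu : {measure set T -> \bar R}) : outer_mu mu set0 = 0%E.
Proof.
apply/eqP; rewrite eq_le outer_mu_ge0 andbT -(measure0 mu).
by apply: ereal_inf_lbound; exists set0 => //; split=> //; exact: measurable0.
Qed.

Lemma outer_muU (R : realType) (d : measure_display) (T : measurableType d)
    (mu : {measure set T -> \bar R}) (A B : set T) :
  (outer_mu mu (A `|` B) <= outer_mu mu A + outer_mu mu B)%E.
Proof.
have A0 := outer_mu_ge0 mu A; have B0 := outer_mu_ge0 mu B.
have [Afin|] := boolP (outer_mu mu A \is a fin_num); last first.
  by rewrite ge0_fin_numE// -leNgt leye_eq => /eqP ->;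
    rewrite addye ?leey// gt_eqF// (lt_le_trans _ B0).
have [Bfin|] := boolP (outer_mu mu B \is a fin_num); last first.
  by rewrite ge0_fin_numE// -leNgt leye_eq => /eqP ->;
    rewrite addey ?leey// gt_eqF// (lt_le_trans _ A0).
apply/lee_addgt0Pr => e e0; have e20 : 0 < e / 2 by rewrite divr_gt0.
have [_ [A' [mA' AA'] <-] lA] := lb_ereal_inf_adherent e20 Afin.
have [_ [B' [mB' BB'] <-] lB] := lb_ereal_inf_adherent e20 Bfin.
apply: (@le_trans _ _ (mu (A' `|` B'))).
  apply: ereal_inf_lbound; exists (A' `|` B') => //.
  by split; [exact: measurableU|exact: setUSS].
apply: le_trans (measureU2 mu mA' mB') _.
rewrite [e%:E](_ : _ = (e / 2)%:E + (e / 2)%:E)%E; last by rewrite -EFinD -splitr.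
by rewrite addeACA; apply: leeD; exact: ltW.
Qed.

Lemma distf_ge0 (R : realType) (d : measure_display) (T : measurableType d)
    (mu : {measure set T -> \bar R}) (g : T -> \bar R) (t : R) : (0 <= distf mu g t)%E.
Proof. exact: outer_mu_ge0. Qed.

Lemma distf_anti (R : realType) (d : measure_display) (T : measurableType d)
    (mu : {measure set T -> \bar R}) (g : T -> \bar R) (s t : R) :
  s <= t -> (distf mu g t <= distf mu g s)%E.
Proof.
by move=> st; apply: outer_mu_le => x /=; apply: le_lt_trans; rewrite lee_fin.
Qed.

Lemma lee_poweR (R : realType) (x y : \bar R) (r : R) :
  0 <= r -> (0 <= x)%E -> (x <= y)%E -> (x `^ r <= y `^ r)%E.
Proof.
move=> r0 x0 xy; apply: gt0_ler_poweR => //; rewrite in_itv/= leey andbT//.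
exact: le_trans xy.
Qed.

(** If y is the larger term, then x + y <= 2 y, and 2^r <= 2 for r <= 1. It is used with exponent
    1/p. *)
Lemma poweRD_le (R : realType) (x y : \bar R) (r : R) :
  0 <= r <= 1 -> (0 <= x)%E -> (0 <= y)%E ->
  ((x + y) `^ r <= 2%:E * (x `^ r + y `^ r))%E.
Proof.
move=> /andP[r0 r1]; wlog xy : x y / (x <= y)%E.
  move=> H x0 y0; have [|/ltW] := leP x y; first by move=> xy; exact: H.
  by move=> yx; rewrite addeC [X in (2%:E * X)%E]addeC; exact: H.
move=> x0 y0; apply: (@le_trans _ _ ((2%:E * y) `^ r)%E).
  apply: lee_poweR => //; first exact: adde_ge0.
  by rewrite mule_natl mule2n; exact: leeD.
rewrite poweRM//; apply: lee_pmul; rewrite ?poweR_ge0//.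
  by rewrite poweR_EFin lee_fin ler1_powR// ler1n.
by rewrite leeDr// poweR_ge0.
Qed.

Definition dyad (R : realType) (d : measure_display) (T : measurableType d)
    (mu : set T -> \bar R) (p : R) (g : T -> \bar R) (k : int) : \bar R :=
  ((2 `^ k%:~R)%:E * distf mu g (2 `^ k%:~R) `^ p^-1)%E.

Lemma dyad_ge0 (R : realType) (d : measure_display) (T : measurableType d)
    (mu : {measure set T -> \bar R}) (p : R) (g : T -> \bar R) (k : int) :
  (0 <= dyad mu p g k)%E.
Proof. by rewrite mule_ge0 ?poweR_ge0// lee_fin pow2_ge0. Qed.

(** If |g| > 2^k, then |g0| or |g1| exceeds 2^(k - 1). One factor 2 comes from 2^k = 2 2^(k - 1),
    the other from taking the power 1/p of a sum. *)
Lemma dyad_quasi_additive (R : realType) (d : measure_display) (T : measurableType d)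
    (mu : {measure set T -> \bar R}) (p : R) (g g0 g1 : T -> \bar R) (k : int) :
  1 <= p -> (forall x, `|g x| <= `|g0 x| + `|g1 x|)%E ->
  (dyad mu p g k <= 4%:E * (dyad mu p g0 (k - 1)%R + dyad mu p g1 (k - 1)%R))%E.
Proof.
move=> p1 gle; have p0 : 0 < p by apply: lt_le_trans p1.
have p01 : 0 <= p^-1 <= 1 by rewrite invr_ge0 (ltW p0)/= invf_le1.
have E2 := pow2_succ R k.
set t : R := 2 `^ (k - 1)%:~R in E2; have t0 : 0 < t by exact: pow2_gt0.
have dle : (distf mu g (2 `^ k%:~R) <= distf mu g0 t + distf mu g1 t)%E.
  apply: le_trans (outer_muU _ _ _); apply: outer_mu_le => x /=; rewrite E2 => gx.
  have [|g0x] := ltP t%:E `|g0 x|%E; [by left|right].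
  rewrite ltNge; apply/negP => g1x; move: gx; rewrite ltNge => /negP; apply.
  apply: (le_trans (gle x)); rewrite mulr2n mulrDl mul1r EFinD; exact: leeD.
have := distf_ge0 mu g0 t; have := distf_ge0 mu g1 t => d1 d0.
apply: (@le_trans _ _ ((2 * t)%:E * (2%:E * (distf mu g0 t `^ p^-1 + distf mu g1 t `^ p^-1)))%E).
  rewrite /dyad E2; apply: lee_wpmul2l; first by rewrite lee_fin mulr_ge0// ltW.
  apply: le_trans (poweRD_le p01 d0 d1).
  by apply: lee_poweR; [have /andP[] := p01|exact: distf_ge0|rewrite -E2; exact: dle].
rewrite /dyad -/t -ge0_muleDr ?poweR_ge0// !muleA -!EFinM.
by have -> : 2 * t * 2 = 4 * t by ring.
Qed.

(** The level j itself need not be selected: what g keeps above 2^j may begin only at a higher level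
    k, and 2^j = 2^(j - k) 2^k gives the geometric factor. With no selected level from j on, g never
    exceeds 2^j in absolute value. *)
Lemma dyad_trunc (R : realType) (d : measure_display) (T : measurableType d)
    (mu : {measure set T -> \bar R}) (p : R) (f g : T -> R) (a : int -> R) (P : int -> bool) :
  1 <= p -> (forall k, 0 <= a k) ->
  (forall k, (dyad mu p (EFin \o f) k <= (a k)%:E)%E) ->
  (forall x, g x != 0 -> g x = f x /\
     exists k, P k /\ 2 `^ k%:~R < `|f x| <= 2 `^ (k + 1)%:~R) ->
  forall j, exists k, (dyad mu p (EFin \o g) j <=
    (2^-1 ^+ absz (j - k)%R * (if P k then a k else 0))%:E)%E.
Proof.
move=> p1 a0 fa gf j; have p0 : 0 < p by apply: lt_le_trans p1.
have level x : 2 `^ j%:~R < `|g x| ->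
    exists n : nat, P (j + n%:Z) /\ 2 `^ (j + n%:Z)%:~R < `|f x|.
  move=> gx; have gx0 : g x != 0.
    by rewrite -normr_gt0; apply: lt_trans gx; exact: pow2_gt0.
  have [gE [k [Pk /andP[k1 k2]]]] := gf x gx0.
  have : j < k + 1.
    by rewrite -(ltr_int R) -ltr_pow2; apply: lt_le_trans k2; rewrite -gE.
  rewrite ltzD1 => jk; exists (absz (k - j)).
  have -> : j + (absz (k - j))%:Z = k by lia.
  by [].
have [[n Pn]|noP] := pselect (exists n : nat, P (j + n%:Z)); last first.
  exists j; rewrite /dyad /distf.
  rewrite (_ : [set x | _] = set0) ?outer_mu0.
    rewrite poweR0r ?invr_eq0 ?gt_eqF// mule0 lee_fin mulr_ge0 ?exprn_ge0//.
    by case: ifP.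
  apply/seteqP; split=> [x|//] /=; rewrite lte_fin => /level[n [Pn _]].
  by apply: noP; exists n.
have exP : exists n : nat, P (j + n%:Z) by exists n.
(* For the least admissible k >= j, {|g| > 2^j} is contained in {|f| > 2^k}. *)
case: (ex_minnP exP) => m Pm mmin; exists (j + m%:Z); rewrite Pm.
have -> : absz (j - (j + m%:Z))%R = m by rewrite opprD addrA subrr add0r abszN absz_nat.
apply: (@le_trans _ _ ((2^-1 ^+ m)%:E * dyad mu p (EFin \o f) (j + m%:Z)%R)%E); last first.
  by rewrite EFinM; apply: lee_wpmul2l => //; rewrite lee_fin exprn_ge0.
rewrite /dyad muleA -EFinM.
have -> : 2^-1 ^+ m * 2 `^ (j + m%:Z)%:~R = 2 `^ j%:~R :> R.
  by rewrite intrD pow2D powR_mulrn// mulrCA -exprMn mulVf// expr1n mulr1.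
apply: lee_wpmul2l; first by rewrite lee_fin pow2_ge0.
apply: lee_poweR; rewrite ?distf_ge0 ?invr_ge0 ?(ltW p0)//.
apply: outer_mu_le => x /=; rewrite !lte_fin => /level[n' [Pn' fx]].
apply: le_lt_trans fx; rewrite ler_pow2 ler_int lerD2l lez_nat; exact: mmin.
Qed.

(* [u] may take the value +oo, so it is bounded through a real majorant. *)
Definition bounded_by_lq (R : realType) (q : \bar R) (u : int -> \bar R) (N : R) : Prop :=
  exists a : int -> R, [/\ (forall k, 0 <= a k), (forall k, (u k <= (a k)%:E)%E)
    & lq_bounded q a N].

(** * Lorentz quasinorms in terms of dyadic sequences *)

(** Countable additivity of the integral is applied to a family indexed by [nat], whereas the dyadic
    intervals are indexed by [int]. *)
Lemma nat_int_bij : exists e : nat -> int, set_bij [set: nat] [set: int] e.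
Proof.
exists (fun n => if odd n then Negz n./2 else Posz n./2); split=> // [m n _ _|[k|k] _].
- move=> emn; rewrite -(odd_double_half m) -(odd_double_half n); move: emn.
  by case: (odd m); case: (odd n) => // -[->].
- by exists k.*2 => //; rewrite odd_double doubleK.
- by exists k.*2.+1 => //=; rewrite odd_double/= uphalf_double.
Qed.

Definition dyadic_itv (R : realType) (k : int) : set R :=
  `]2 `^ (k - 1)%:~R, 2 `^ k%:~R]%classic.

Arguments dyadic_itv : clear implicits.

Lemma dyadic_itvP (R : realType) (k : int) (x : R) :
  dyadic_itv R k x <-> 2 `^ (k - 1)%:~R < x <= 2 `^ k%:~R.
Proof. by rewrite /dyadic_itv/= in_itv. Qed.

Lemma measurable_dyadic_itv (R : realType) (k : int) : measurable (dyadic_itv R k).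
Proof. exact: measurable_itv. Qed.

Lemma dyadic_itvE (R : realType) :
  `]0, +oo[%classic = \bigcup_(k in [set: int]) dyadic_itv R k :> set R.
Proof.
apply/seteqP; split=> x /=; rewrite in_itv/= andbT.
  move=> x0; have [m] := pow2_level ltr01 x0; rewrite !mul1r => xm.
  by exists (m + 1) => //; apply/dyadic_itvP; rewrite addrK intrD mulr1z.
by move=> [k _] /dyadic_itvP/andP[+ _]; apply: lt_trans; exact: pow2_gt0.
Qed.

Lemma integral_dyadic (R : realType) (F : R -> \bar R) :
  measurable_fun (`]0, +oo[%classic : set R) F -> (forall x, 0 < x -> (0 <= F x)%E) ->
  (\int[lebesgue_measure]_(x in `]0%R, +oo[) F x =
   \esum_(k in [set: int]) \int[lebesgue_measure]_(x in dyadic_itv R k) F x)%E.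
Proof.
move=> mF F0; have [e be] := nat_int_bij.
pose J := dyadic_itv R.
have JE : `]0, +oo[%classic = \bigcup_n J (e n) :> set R.
  rewrite dyadic_itvE (reindex_bigcup e [set: nat])//; first by case: be.
rewrite JE; have -> := @ge0_integral_bigcup _ _ R lebesgue_measure (J \o e) F.
- rewrite nneseries_esumT; last first.
    move=> n; apply: integral_ge0 => x /dyadic_itvP/andP[x0 _].
    by apply: F0; apply: lt_trans x0; exact: pow2_gt0.
  by rewrite [RHS](@reindex_esum _ _ _ [set: nat] _ e).
- by move=> n; exact: measurable_itv.
- by rewrite -JE.
- by move=> x; rewrite -JE /= in_itv/= andbT; exact: F0.
- apply/trivIsetP => i j _ _ ij; apply/seteqP; split=> // x []
  /dyadic_itvP/andP[i1 i2] /dyadic_itvP/andP[j1 j2].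
  have eij : e i = e j.
    have := lt_le_trans i1 j2; have := lt_le_trans j1 i2.
    by rewrite !ltr_pow2 !ltr_int => ? ?; lia.
  move: ij; suff -> : i = j by rewrite eqxx.
  by case: be => _ inj _; apply: inj => //; rewrite inE.
Qed.

(** An antitone function pulls upper rays back to intervals. This covers every g, in particular a
    maximal function. *)
Lemma measurable_distf (R : realType) (d : measure_display) (T : measurableType d)
    (mu : {measure set T -> \bar R}) (g : T -> \bar R) (D : set R) :
  measurable_fun D (distf mu g).
Proof.
move=> mD; apply: (measurability _ (ErealGenCInfty.measurableE R)) => //.
move=> _ [_ [y ->] <-]; apply: measurableI => //; apply: is_interval_measurable.
move=> s t /= + + u /andP[su ut]; rewrite !in_itv/= !andbT => _ ty.
by apply: (le_trans ty); exact: distf_anti.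
Qed.

Definition lorentz_integrand (R : realType) (d : measure_display) (T : measurableType d)
    (mu : set T -> \bar R) (p r : R) (g : T -> \bar R) (t : R) : \bar R :=
  ((t%:E * distf mu g t `^ p^-1) `^ r * (t^-1)%:E)%E.

Lemma lorentz_integrand_ge0 (R : realType) (d : measure_display) (T : measurableType d)
    (mu : {measure set T -> \bar R}) (p r : R) (g : T -> \bar R) (t : R) :
  0 < t -> (0 <= lorentz_integrand mu p r g t)%E.
Proof.
by move=> t0; rewrite mule_ge0 ?poweR_ge0// lee_fin invr_ge0 ltW.
Qed.

Lemma measurable_lorentz_integrand (R : realType) (d : measure_display) (T : measurableType d)
    (mu : {measure set T -> \bar R}) (p r : R) (g : T -> \bar R) :
  measurable_fun (`]0, +oo[%classic : set R) (lorentz_integrand mu p r g).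
Proof.
apply: emeasurable_funM.
  apply: (@measurableT_comp _ _ _ _ _ _ (fun x : \bar R => x `^ r)%E).
    exact: measurable_poweR.
  apply: emeasurable_funM; first exact: measurable_funTS.
  apply: (@measurableT_comp _ _ _ _ _ _ (fun x : \bar R => x `^ p^-1)%E).
    exact: measurable_poweR.
  exact: measurable_distf.
apply/measurable_EFinP; apply: (@eq_measurable_fun _ _ _ _ _ (fun t : R => t `^ (-1))).
  by move=> t; rewrite inE/= in_itv/= andbT => t0; rewrite powR_inv1// ltW.
by apply: measurable_funTS; exact: measurable_powR.
Qed.

Lemma lebesgue_dyadic (R : realType) (k : int) :
  lebesgue_measure (dyadic_itv R k) =
  (2 `^ (k - 1)%:~R)%:E.
Proof.
rewrite /dyadic_itv lebesgue_measure_itv/= lte_fin ltr_pow2 ltr_int gtrBl ltr01.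
by rewrite -EFinB pow2_succ; congr EFin; ring.
Qed.

(** On (u, 2u] the integrand is largest when t is replaced by 2u in the factor t and by u in the
    distribution function and in 1/t; the length u then cancels 1/u. The index k - 1 is that of the
    lower endpoint. *)
Lemma integral_dyadic_le (R : realType) (d : measure_display) (T : measurableType d)
    (mu : {measure set T -> \bar R}) (p r : R) (g : T -> \bar R) (k : int) :
  1 <= p -> 1 <= r ->
  (\int[lebesgue_measure]_(t in dyadic_itv R k) lorentz_integrand mu p r g t
    <= (2%:E * dyad mu p g (k - 1)%R) `^ r)%E.
Proof.
move=> p1 r1; have p0 : 0 < p by apply: lt_le_trans p1.
have r0 : 0 < r by apply: lt_le_trans r1.
set u : R := 2 `^ (k - 1)%:~R; have u0 : 0 < u by exact: pow2_gt0.
have E2 : 2 `^ k%:~R = 2 * u by rewrite pow2_succ.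
pose c := (((2%:E * dyad mu p g (k - 1)%R) `^ r) * (u^-1)%:E)%E.
have D0 t : (0 <= distf mu g t `^ p^-1)%E by exact: poweR_ge0.
apply: (@le_trans _ _ (\int[lebesgue_measure]_(t in dyadic_itv R k) cst c t)%E).
  apply: ge0_le_integral => //.
  - exact: measurable_dyadic_itv.
  - move=> t /dyadic_itvP/andP[ut _].
    by apply: lorentz_integrand_ge0; exact: lt_trans ut.
  - apply: measurable_funS (measurable_lorentz_integrand mu p r g) => //.
    by move=> t /dyadic_itvP/andP[ut _]; rewrite /= in_itv/= andbT; exact: lt_trans ut.
  move=> t /dyadic_itvP; rewrite E2 => /andP[ut t2]; have t0 : 0 < t by exact: lt_trans ut.
  apply: lee_pmul; rewrite ?poweR_ge0 ?lee_fin ?invr_ge0 ?(ltW t0)//; last first.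
    by rewrite lef_pV2 ?posrE// ltW.
  apply: lee_poweR; [exact: ltW|by rewrite mule_ge0// lee_fin ltW|].
  rewrite /dyad -/u muleA -EFinM; apply: lee_pmul => //; first by rewrite lee_fin ltW.
  apply: lee_poweR; [by rewrite invr_ge0 ltW|exact: distf_ge0|].
  by apply: distf_anti; exact: ltW.
rewrite integral_cst; last exact: measurable_dyadic_itv.
rewrite [X in (_ * X)%E]lebesgue_dyadic -/u /c -muleA -EFinM mulVf ?gt_eqF//.
by rewrite mule1.
Qed.

(** The opposite replacements lose 2^r from the factor t and 2 from 1/t, and 2 2^r <= 4^r since r >=
    1. The index k is that of the upper endpoint. *)
Lemma integral_dyadic_ge (R : realType) (d : measure_display) (T : measurableType d)
    (mu : {measure set T -> \bar R}) (p r : R) (g : T -> \bar R) (k : int) :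
  1 <= p -> 1 <= r ->
  (dyad mu p g k `^ r <= (4 `^ r)%:E *
   \int[lebesgue_measure]_(t in dyadic_itv R k) lorentz_integrand mu p r g t)%E.
Proof.
move=> p1 r1; have p0 : 0 < p by apply: lt_le_trans p1.
have r0 : 0 < r by apply: lt_le_trans r1.
set u : R := 2 `^ (k - 1)%:~R; have u0 : 0 < u by exact: pow2_gt0.
have E2 : 2 `^ k%:~R = 2 * u by exact: pow2_succ.
have D0 t : (0 <= distf mu g t `^ p^-1)%E by exact: poweR_ge0.
pose c := (((2^-1)%:E * dyad mu p g k) `^ r * ((2 * u)^-1)%:E)%E.
have c0 : (0 <= c)%E by rewrite mule_ge0 ?poweR_ge0// lee_fin invr_ge0 mulr_ge0// ltW.
apply: (@le_trans _ _ ((4 `^ r)%:E *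
    \int[lebesgue_measure]_(t in dyadic_itv R k) cst c t)%E); last first.
  apply: lee_wpmul2l; first by rewrite lee_fin powR_ge0.
  apply: ge0_le_integral => //.
  - exact: measurable_dyadic_itv.
  - apply: measurable_funS (measurable_lorentz_integrand mu p r g) => //.
    by move=> t /dyadic_itvP/andP[ut _]; rewrite /= in_itv/= andbT; exact: lt_trans ut.
  move=> t /dyadic_itvP; rewrite E2 => /andP[ut t2]; have t0 : 0 < t by exact: lt_trans ut.
  apply: lee_pmul; rewrite ?poweR_ge0 ?lee_fin ?invr_ge0 ?mulr_ge0 ?(ltW u0)//; last first.
    by rewrite lef_pV2 ?posrE ?mulr_gt0.
  apply: lee_poweR; [exact: ltW|by rewrite mule_ge0// ?dyad_ge0// lee_fin|].
  rewrite /dyad E2 muleA -EFinM mulKf//; apply: lee_pmul => //; first by rewrite lee_fin ltW.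
    by rewrite lee_fin ltW.
  apply: lee_poweR; [by rewrite invr_ge0 ltW|exact: distf_ge0|].
  exact: distf_anti.
rewrite integral_cst; last exact: measurable_dyadic_itv.
rewrite [X in (_ * (_ * X))%E]lebesgue_dyadic -/u /c -muleA -EFinM invfM mulfVK ?gt_eqF//.
rewrite poweRM ?dyad_ge0 ?lee_fin// poweR_EFin.
set X := (dyad _ _ _ _ `^ r)%E; set A := 4 `^ r; set B := 2^-1 `^ r.
have -> : (A%:E * (B%:E * X * (2^-1)%:E) = X * (A * B * 2^-1)%:E)%E.
  by rewrite (muleC B%:E) !EFinM -!muleA [LHS]muleCA.
rewrite -[leLHS]mule1; apply: lee_wpmul2l; first exact: poweR_ge0.
rewrite lee_fin -powRM// (_ : 4 / 2 = 2) //; last by field.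
rewrite ler_pdivlMr// mul1r -[leLHS](powRr1 (ler0n _ 2)).
by apply: ler_powR => //; rewrite ler1n.
Qed.

Lemma lorentz_bounded (R : realType) (d : measure_display) (T : measurableType d)
    (mu : {measure set T -> \bar R}) (p : R) (q : \bar R) (g : T -> \bar R) (N : R) :
  1 <= p -> (1 <= q)%E -> 0 <= N ->
  (lorentz_norm mu p q g <= N%:E)%E -> bounded_by_lq q (dyad mu p g) (4 * N).
Proof.
move=> p1 q1 N0; have p0 : 0 < p by apply: lt_le_trans p1.
case: q q1 => [r| |]//; last first.
  move=> _ gN; have dN k : (dyad mu p g k <= N%:E)%E.
    apply: le_trans gN; apply: ereal_sup_ubound.
    by exists (2 `^ k%:~R); rewrite //= in_itv/= andbT pow2_gt0.
  exists (fun _ => 4 * N); split=> //= [k|k]; first by rewrite mulr_ge0.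
  by apply: (le_trans (dN k)); rewrite lee_fin; lra.
rewrite lee_fin => r1; have r0 : 0 < r by apply: lt_le_trans r1.
rewrite /lorentz_norm -/(lorentz_integrand mu p r g).
set I := (\int[_]_(_ in _) _)%E => gN.
have I0 : (0 <= I)%E.
  apply: integral_ge0 => t; rewrite /= in_itv/= andbT => t0.
  exact: lorentz_integrand_ge0.
have IN : (I <= (N `^ r)%:E)%E.
  have : (I `^ r^-1 <= N%:E)%E.
    apply: le_trans gN; rewrite -[leLHS]mul1e; apply: lee_wpmul2r; first exact: poweR_ge0.
    by rewrite lee_fin -[leLHS](powRr0 p) ler_powR// invr_ge0 ltW.
  move=> /(lee_poweR (ltW r0) (poweR_ge0 _ _)).
  by rewrite -poweRrM mulVf ?gt_eqF// poweRe1.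
have S : (\esum_(k in [set: int]) (dyad mu p g k `^ r) <= ((4 * N) `^ r)%:E)%E.
  rewrite powRM// EFinM; apply: (@le_trans _ _ ((4 `^ r)%:E * I)%E); last first.
    by apply: lee_wpmul2l => //; rewrite lee_fin powR_ge0.
  rewrite /I integral_dyadic; last 2 first.
  - exact: measurable_lorentz_integrand.
  - exact: lorentz_integrand_ge0.
  rewrite -esumZ ?powR_ge0//; last first.
    move=> k; apply: integral_ge0 => t /dyadic_itvP/andP[t0 _].
    by apply: lorentz_integrand_ge0; apply: lt_trans t0; exact: pow2_gt0.
  by apply: le_esum => k _; exact: integral_dyadic_ge.
(* A single r-th power is at most the finite sum [S], so the dyadic sequence serves as its own real
   majorant. *)
have dfin k : dyad mu p g k \is a fin_num.
  rewrite ge0_fin_numE ?dyad_ge0//; apply: (@lty_poweRy _ _ r); first by rewrite gt_eqF.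
  apply: le_lt_trans (ltry ((4 * N) `^ r)); apply: le_trans S.
  by apply: (esum_ge_term (a := fun k => (dyad mu p g k `^ r)%E)) => i; exact: poweR_ge0.
exists (fun k => fine (dyad mu p g k)); split=> [k|k|].
- by rewrite fine_ge0 ?dyad_ge0.
- by rewrite fineK.
- rewrite /=; apply: le_trans S; apply: le_esum => k _.
  by rewrite -[in leRHS](fineK (dfin k)).
Qed.

Lemma bounded_lorentz (R : realType) (d : measure_display) (T : measurableType d)
    (mu : {measure set T -> \bar R}) (p : R) (q : \bar R) (g : T -> \bar R) (N : R) :
  1 <= p -> (1 <= q)%E -> 0 <= N -> bounded_by_lq q (dyad mu p g) N ->
  (lorentz_norm mu p q g <= (2 * p * N)%:E)%E.
Proof.
move=> p1 q1 N0 [a [a0 ga aN]]; have p0 : 0 < p by apply: lt_le_trans p1.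
case: q q1 aN => [r| |]//; last first.
  move=> _ /= aN; apply: ge_ereal_sup => x [t] /=; rewrite in_itv/= andbT => t0 <- {x}.
  have [m] := pow2_level ltr01 t0; rewrite !mul1r => /andP[mt tm].
  apply: (@le_trans _ _ (2%:E * dyad mu p g m)%E).
    rewrite /dyad muleA -EFinM; apply: lee_pmul; rewrite ?poweR_ge0 ?lee_fin ?(ltW t0)//.
      by rewrite mulrC -[X in _ * X](powRr1 (ler0n _ 2)) -pow2D.
    apply: lee_poweR; [by rewrite invr_ge0 ltW|exact: distf_ge0|].
    by apply: distf_anti; exact: ltW.
  apply: (@le_trans _ _ (2%:E * N%:E)%E).
    by apply: lee_wpmul2l => //; apply: (le_trans (ga m)); rewrite lee_fin.
  by rewrite -EFinM lee_fin; nra.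
rewrite lee_fin => r1 /= aN; have r0 : 0 < r by apply: lt_le_trans r1.
rewrite -/(lorentz_integrand mu p r g) integral_dyadic; last 2 first.
- exact: measurable_lorentz_integrand.
- exact: lorentz_integrand_ge0.
set I := (\esum_(k in _) _)%E.
have I0 : (0 <= I)%E.
  apply: esum_ge0 => k _; apply: integral_ge0 => t /dyadic_itvP/andP[t0 _].
  by apply: lorentz_integrand_ge0; apply: lt_trans t0; exact: pow2_gt0.
have IN : (I <= ((2 * N) `^ r)%:E)%E.
  rewrite powRM// EFinM.
  apply: (@le_trans _ _ (\esum_(k in [set: int]) ((2 `^ r)%:E * (a (k - 1)%R `^ r)%:E))%E).
    apply: le_esum => k _; apply: le_trans (integral_dyadic_le mu g k p1 r1) _.
    rewrite -EFinM -powRM// -poweR_EFin; apply: lee_poweR; first exact: ltW.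
      by rewrite mule_ge0// dyad_ge0.
    by rewrite EFinM; apply: lee_wpmul2l.
  rewrite esumZ ?powR_ge0//; last by move=> k; rewrite lee_fin powR_ge0.
  apply: lee_wpmul2l; first by rewrite lee_fin powR_ge0.
  by rewrite (esum_shift (fun k => (a k `^ r)%:E)).
apply: (@le_trans _ _ ((p `^ r^-1)%:E * (2 * N)%:E)%E).
  apply: lee_wpmul2l; first by rewrite lee_fin powR_ge0.
  apply: le_trans (lee_poweR _ I0 IN) _; first by rewrite invr_ge0 ltW.
  by rewrite poweR_EFin -powRrM mulfV ?gt_eqF// powRr1// mulr_ge0.
rewrite -EFinM lee_fin; have : p `^ r^-1 <= p by rewrite ler1_powR// invf_le1.
nra.
Qed.

(** * The centered maximal function *)

Lemma mball_measurable (R : realType) (d : measure_display) (T : measurableType d)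
    (rho : T -> T -> R) :
  is_metric rho -> (@measurable d T = <<s metric_open rho >>) ->
  forall x s, measurable (mball rho x s).
Proof.
move=> [_ [_ tri]] -> x s; apply: sub_sigma_algebra => y /= xy.
exists (s - rho x y); first by rewrite subr_gt0.
move=> z; rewrite /mball/= ltrBrDl; apply: le_lt_trans; exact: tri.
Qed.

Lemma maxfun_c_ge0 (R : realType) (d : measure_display) (T : measurableType d)
    (rho : T -> T -> R) (mu : set T -> \bar R) (f : T -> R) (x : T) :
  (0 <= maxfun_c rho mu f x)%E.
Proof. by apply: ereal_sup_ubound; left. Qed.

Lemma maxfun_c_subadditive (R : realType) (d : measure_display) (T : measurableType d)
    (rho : T -> T -> R) (mu : {measure set T -> \bar R}) (f f0 f1 : T -> R) (x : T) :
  (forall x s, measurable (mball rho x s)) ->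
  measurable_fun setT f -> measurable_fun setT f0 -> measurable_fun setT f1 ->
  (forall y, f y = f0 y + f1 y) ->
  (maxfun_c rho mu f x <= maxfun_c rho mu f0 x + maxfun_c rho mu f1 x)%E.
Proof.
move=> mB mf mf0 mf1 fE; apply: ge_ereal_sup => _ [->|[s /= [s0 Bs] <-]].
  by rewrite adde_ge0 ?maxfun_c_ge0.
set B := mball rho x s; set c := (fine (mu B))^-1.
have c0 : (0 <= c%:E)%E by rewrite lee_fin invr_ge0 fine_ge0.
have mabs (g : T -> R) : measurable_fun setT g -> measurable_fun B (fun y => `|(g y)%:E|%E).
  by move=> mg; apply: measurable_funTS; apply: measurableT_comp => //; exact/measurable_EFinP.
apply: (@le_trans _ _ (c%:E * (\int[mu]_(y in B) `|(f0 y)%:E| + \int[mu]_(y in B) `|(f1 y)%:E|))%E).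
  apply: lee_wpmul2l => //.
  rewrite -ge0_integralD//; last 3 first.
  - exact: mB.
  - exact: mabs.
  - exact: mabs.
  apply: ge0_le_integral => //.
  - exact: mB.
  - exact: mabs.
  - by apply: emeasurable_funD; exact: mabs.
  - by move=> y _; rewrite /= fE -EFinD lee_fin; exact: ler_normD.
rewrite ge0_muleDr ?integral_ge0//; apply: leeD.
  by apply: ereal_sup_ubound; right; exists s.
by apply: ereal_sup_ubound; right; exists s.
Qed.

Lemma lorentz_norm_ge0 (R : realType) (d : measure_display) (T : measurableType d)
    (mu : {measure set T -> \bar R}) (p : R) (q : \bar R) (g : T -> \bar R) :
  (0 <= lorentz_norm mu p q g)%E.
Proof.
case: q => [r| |] //=; first by rewrite mule_ge0 ?poweR_ge0// lee_fin powR_ge0.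
apply: (@le_trans _ _ (1%:E * distf mu g 1 `^ p^-1)%E).
  by rewrite mule_ge0// poweR_ge0.
by apply: ereal_sup_ubound; exists 1 => //=; rewrite in_itv/= andbT ltr01.
Qed.

(** * Transfer between Lorentz bounds and sequence bounds *)

(** The constant is a parameter so that both endpoint bounds can be brought to a common one. *)
Definition maxfun_lq_bounded (R : realType) (d : measure_display) (T : measurableType d)
    (rho : T -> T -> R) (mu : set T -> \bar R) (p : R) (q r : \bar R) (C : R) : Prop :=
  forall f : T -> R, measurable_fun setT f -> forall N, 0 <= N ->
    bounded_by_lq q (dyad mu p (EFin \o f)) N ->
    bounded_by_lq r (dyad mu p (maxfun_c rho mu f)) (C * N).

Lemma maxfun_bounded_lq (R : realType) (d : measure_display) (T : measurableType d)
    (rho : T -> T -> R) (mu : {measure set T -> \bar R}) (p : R) (q r : \bar R) :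
  1 <= p -> (1 <= q)%E -> (1 <= r)%E -> maxfun_bounded rho mu p q r ->
  exists2 C, 0 < C & maxfun_lq_bounded rho mu p q r C.
Proof.
move=> p1 q1 r1 [C HC]; have p0 : 0 < p by apply: lt_le_trans p1.
(* The given C may have any sign, while the sequence argument asks for a positive constant. The
   factors 2 p and 4 come from the two comparisons of quasinorms. *)
have C0 : 0 < `|C| + 1 by rewrite ltr_wpDl.
exists (4 * ((`|C| + 1) * (2 * p))); first by rewrite !mulr_gt0.
move=> f mf N N0 fN; have Lf := bounded_lorentz p1 q1 N0 fN.
rewrite -mulrA -mulrA; apply: lorentz_bounded => //.
  by rewrite !mulr_ge0// ltW.
apply: le_trans (HC f mf (le_lt_trans Lf (ltry _))) _.
rewrite EFinM; apply: (@le_trans _ _ ((`|C| + 1)%:E * lorentz_norm mu p q (EFin \o f))%E).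
  apply: lee_wpmul2r; first exact: lorentz_norm_ge0.
  by rewrite lee_fin (le_trans (ler_norm _))// lerDl.
by apply: lee_wpmul2l => //; rewrite lee_fin ltW.
Qed.

Lemma maxfun_lq_bounded_lorentz (R : realType) (d : measure_display) (T : measurableType d)
    (rho : T -> T -> R) (mu : {measure set T -> \bar R}) (p : R) (q r : \bar R) (C : R) :
  1 <= p -> (1 <= q)%E -> (1 <= r)%E -> 0 < C ->
  (forall f : T -> R, measurable_fun setT f -> forall N, 0 < N ->
    bounded_by_lq q (dyad mu p (EFin \o f)) N ->
    bounded_by_lq r (dyad mu p (maxfun_c rho mu f)) (C * N)) ->
  maxfun_bounded rho mu p q r.
Proof.
move=> p1 q1 r1 C0 HC; have p0 : 0 < p by apply: lt_le_trans p1.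
exists (2 * p * C * 4) => f mf; have := lorentz_norm_ge0 mu p q (fun x => (f x)%:E).
case E : (lorentz_norm mu p q (fun x => (f x)%:E)) => [l| |]//; rewrite lee_fin => l0 _.
have K0 : 0 < 2 * p * C * 4 by rewrite !mulr_gt0.
(* The hypothesis asks for N > 0 but the quasinorm l may vanish, so it is applied to l plus a
   multiple of e, scaled to cost exactly e in the end. *)
apply/lee_addgt0Pr => e e0; rewrite -EFinM -EFinD.
have e'0 : 0 < l + e / (2 * p * C * 4) by rewrite ltr_wpDl// divr_gt0.
have -> : 2 * p * C * 4 * l + e = 2 * p * (C * (4 * (l + e / (2 * p * C * 4)))).
  by field; rewrite !gt_eqF.
apply: bounded_lorentz => //; first by rewrite !mulr_ge0// ltW.
apply: HC => //; first by rewrite mulr_gt0.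
apply: lorentz_bounded => //; first exact: ltW.
by rewrite E lee_fin lerDl divr_ge0// ltW.
Qed.

(** * Interpolation for the maximal function *)

Lemma bounded_by_lq_trunc (R : realType) (d : measure_display) (T : measurableType d)
    (mu : {measure set T -> \bar R}) (p : R) (q : \bar R) (f g : T -> R) (a : int -> R)
    (P : int -> bool) (M : R) :
  1 <= p -> (1 <= q)%E -> (forall k, 0 <= a k) -> 0 <= M ->
  (forall k, (dyad mu p (EFin \o f) k <= (a k)%:E)%E) ->
  (forall x, g x != 0 -> g x = f x /\
     exists k, P k /\ 2 `^ k%:~R < `|f x| <= 2 `^ (k + 1)%:~R) ->
  lq_bounded q (fun k => if P k then a k else 0) M ->
  bounded_by_lq q (dyad mu p (EFin \o g)) (4 * M).
Proof.
move=> p1 q1 a0 M0 fa gf aM; have tr := dyad_trunc p1 a0 fa gf.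
have gfin j : dyad mu p (EFin \o g) j \is a fin_num.
  by rewrite ge0_fin_numE ?dyad_ge0//; have [k /le_lt_trans->//] := tr j; exact: ltry.
exists (fun j => fine (dyad mu p (EFin \o g) j)); split=> [k|k|].
- by rewrite fine_ge0 ?dyad_ge0.
- by rewrite fineK.
apply: lq_bounded_smear aM => // [k|k|j]; first by case: ifP.
  by rewrite fine_ge0 ?dyad_ge0.
by have [k kj] := tr j; exists k; rewrite -lee_fin fineK.
Qed.

Lemma bounded_by_lq_le (R : realType) (q r : \bar R) (u : int -> \bar R) (N : R) :
  (1 <= q)%E -> (q <= r)%E -> 0 <= N ->
  bounded_by_lq q u N -> bounded_by_lq r u N.
Proof.
move=> q1 qr N0 [a [a0 ua aN]]; exists a; split=> //.
exact: lq_bounded_exponent aN.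
Qed.

Lemma bounded_by_lq_fine (R : realType) (q : \bar R) (u : int -> \bar R) (N : R) :
  (1 <= q)%E -> (forall k, 0 <= u k)%E -> 0 <= N -> bounded_by_lq q u N ->
  (forall k, u k \is a fin_num) /\ lq_bounded q (fine \o u) N.
Proof.
move=> q1 u0 N0 [a [a0 ua aN]]; have ufin k : u k \is a fin_num.
  by rewrite ge0_fin_numE// (le_lt_trans (ua k))// ltry.
split=> //; apply: lq_bounded_le aN => // [k|k|].
- by rewrite /= fine_ge0.
- by rewrite -lee_fin fineK.
- by rewrite N0 lexx.
Qed.

(* 16 C: truncating f costs a factor 4, and the quasi-additivity of [dyad] another 4. *)
Lemma maxfun_lq_interpolation (R : realType) (d : measure_display) (T : measurableType d)
    (rho : T -> T -> R) (mu : {measure set T -> \bar R}) (p q0 r0 q r eta C : R)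
    (q1 r1 : \bar R) :
  (forall x s, measurable (mball rho x s)) ->
  1 <= p -> 1 <= q0 -> q0 <= r0 -> q0 < q -> (q%:E < q1)%E -> (q1 <= r1)%E ->
  1 <= r -> 0 < eta -> 0 < C ->
  eta * (1 - r / r0) = 1 - q / q0 ->
  eta * (1 - r * einv r1) = 1 - q * einv q1 ->
  maxfun_lq_bounded rho mu p q0%:E r0%:E C ->
  maxfun_lq_bounded rho mu p q1 r1 C ->
  forall f : T -> R, measurable_fun setT f -> forall N, 0 < N ->
    bounded_by_lq q%:E (dyad mu p (EFin \o f)) N ->
    bounded_by_lq r%:E (dyad mu p (maxfun_c rho mu f))
      (marcinkiewicz_const q0 q1 q r eta (16 * C) * N).
Proof.
move=> mB p1 q01 q0r0 q0q qq1 q1r1 r_ge1 eta0 C0 Heta0 Heta1 M0 M1 f mf N N0 [a [a0 fa aN]].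
have q_gt0 : 0 < q by apply: lt_trans q0q; apply: lt_le_trans q01.
have q11 : (1 <= q1)%E by apply: le_trans (ltW qq1); rewrite lee_fin (le_trans q01)// ltW.
have r11 : (1 <= r1)%E by exact: le_trans q1r1.
have r01 : 1 <= r0 by exact: le_trans q0r0.
have dM0 g k : (0 <= dyad mu p (maxfun_c rho mu g) k)%E by exact: dyad_ge0.
(* Treats both parts of f at once. Finiteness makes [fine] harmless; the shift to j - 1 and the
   factor 4 anticipate [dyad_quasi_additive]. *)
have trunc (qi ri : \bar R) (P : int -> bool) (g : T -> R) :
    (1 <= qi)%E -> (1 <= ri)%E -> maxfun_lq_bounded rho mu p qi ri C ->
    measurable_fun setT g ->
    (forall x, g x != 0 -> g x = f x /\
       exists k, P k /\ 2 `^ k%:~R < `|f x| <= 2 `^ (k + 1)%:~R) ->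
    (exists2 M, 0 <= M & lq_bounded qi (fun k => if P k then a k else 0) M) ->
    (forall k, dyad mu p (maxfun_c rho mu g) k \is a fin_num) /\
    (forall M, 0 <= M -> lq_bounded qi (fun k => if P k then a k else 0) M ->
       lq_bounded ri (fun j => 4 * fine (dyad mu p (maxfun_c rho mu g) (j - 1))) (16 * C * M)).
  move=> qi1 ri1 Mi mg gf [M' M'0 aM'].
  have bnd M : 0 <= M -> lq_bounded qi (fun k => if P k then a k else 0) M ->
      (forall k, dyad mu p (maxfun_c rho mu g) k \is a fin_num) /\
      lq_bounded ri (fine \o dyad mu p (maxfun_c rho mu g)) (C * (4 * M)).
    move=> M_ge0 aM; apply: bounded_by_lq_fine => //.
      by rewrite !mulr_ge0// ltW.
    apply: Mi => //; first by rewrite mulr_ge0.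
    exact: bounded_by_lq_trunc aM.
  split=> [|M M_ge0 /(bnd _ M_ge0)[_ gM]]; first by have [] := bnd _ M'0 aM'.
  have -> : 16 * C * M = 4 * (C * (4 * M)) by ring.
  have := lq_bounded_shift (-1) gM.
  apply: lq_boundedZ => // [k|]; first by rewrite /= fine_ge0.
  by rewrite !mulr_ge0// ltW.
have dec s : 0 < s -> exists b0 b1, [/\ (forall j, 0 <= b0 j), (forall j, 0 <= b1 j),
     (forall j, (dyad mu p (maxfun_c rho mu f) j <= (b0 j + b1 j)%:E)%E),
     (forall M, 0 <= M -> lq_bounded q0%:E (fun k => if s < a k then a k else 0) M ->
        lq_bounded r0%:E b0 (16 * C * M)) &
     (forall M, 0 <= M -> lq_bounded q1 (fun k => if s < a k then 0 else a k) M ->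
        lq_bounded r1 b1 (16 * C * M))].
  move=> s0.
  (* The part [f0] lives on the levels whose coefficient exceeds s and [f1] on the others, so
     cutting f mirrors cutting a. *)
  pose L k := [set x | s < a k /\ 2 `^ k%:~R < `|f x| <= 2 `^ (k + 1)%:~R].
  pose A := \bigcup_(k in [set: int]) L k.
  have mA : measurable A.
    apply: countable_bigcupT_measurable => [|k]; first exact: countableP.
    rewrite /L; have [sa|sa] := boolP (s < a k); last first.
      by rewrite [X in measurable X](_ : _ = set0)//; apply/seteqP; split=> // x [].
    (* [dyadic_itv] is indexed by its upper endpoint, hence k + 1. *)
    rewrite [X in measurable X](_ : _ = setT `&` (Num.norm \o f) @^-1` dyadic_itv R (k + 1)).
      have : measurable_fun setT (Num.norm \o f) by exact: measurableT_comp.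
      by apply; [exact: measurableT|exact: measurable_dyadic_itv].
    apply/seteqP; split=> x /=.
      by move=> [_ xk]; split=> //; apply/dyadic_itvP; rewrite addrK.
    by move=> [_ /dyadic_itvP]; rewrite addrK.
  pose f0 x := f x * \1_A x; pose f1 x := f x * \1_(~` A) x.
  have mf0 : measurable_fun setT f0 by apply: measurable_funM => //; exact: measurable_indic.
  have mf1 : measurable_fun setT f1.
    by apply: measurable_funM => //; apply: measurable_indic; exact: measurableC.
  have fE x : f x = f0 x + f1 x.
    rewrite /f0 /f1 !indicE in_setC; case: (x \in A); rewrite ?mulr1 ?mulr0 ?addr0//.
    by rewrite add0r.
  have s_ge0 := ltW s0; have N_ge0 := ltW N0.
  have gf0 x : f0 x != 0 -> f0 x = f x /\
      exists k, s < a k /\ 2 `^ k%:~R < `|f x| <= 2 `^ (k + 1)%:~R.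
    rewrite /f0 indicE; case: (boolP (x \in A)) => [|_]; last by rewrite mulr0 eqxx.
    by rewrite inE mulr1 => -[k _ Lk] _; split=> //; exists k.
  have gf1 x : f1 x != 0 -> f1 x = f x /\
      exists k, ~~ (s < a k) /\ 2 `^ k%:~R < `|f x| <= 2 `^ (k + 1)%:~R.
    rewrite /f1 indicE in_setC; case: (boolP (x \in A)) => [_|]; first by rewrite mulr0 eqxx.
    rewrite notin_setE mulr1 => xA fx0; split=> //.
    have fx : 0 < `|f x| by rewrite normr_gt0.
    have [m] := pow2_level ltr01 fx; rewrite !mul1r => xm; exists m.
    have xm' : 2 `^ m%:~R < `|f x| <= 2 `^ (m + 1)%:~R by rewrite intrD mulr1z.
    by split=> //; apply/negP => sa; apply: xA; exists m.
  (* The implications to be proved could hold vacuously, so finiteness requires one actual bound: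
     a_k > s suits q0 < q, and a_k <= s suits q < q1. *)
  have ex0 : exists2 M, 0 <= M & lq_bounded q0%:E (fun k => if s < a k then a k else 0) M.
    apply: (lq_bounded_trunc (P := fun k => s < a k) q_gt0 _ s_ge0 N_ge0 a0 aN) => //.
    move=> k x [<-] ak; move: s0 => /pow2_surj[z ->]; move: ak => /pow2_surj[y ->].
    by rewrite ltr_pow2 -!powRrM ler_pow2 => zy; nra.
  have ex1 : exists2 M, 0 <= M & lq_bounded q1 (fun k => if ~~ (s < a k) then a k else 0) M.
    apply: (lq_bounded_trunc (P := fun k => ~~ (s < a k)) q_gt0 _ s_ge0 N_ge0 a0 aN) => //.
      by move=> _ k; rewrite -leNgt.
    move=> k x q1x ak; rewrite -leNgt; move: s0 => /pow2_surj[z ->]; move: ak => /pow2_surj[y ->].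
    move: qq1; rewrite q1x lte_fin => qx.
    by rewrite ler_pow2 -!powRrM ler_pow2 => zy; nra.
  have [fin0 bnd0] := trunc q0%:E r0%:E (fun k => s < a k) f0 q01 r01 M0 mf0 gf0 ex0.
  have [fin1 bnd1] := trunc q1 r1 (fun k => ~~ (s < a k)) f1 q11 r11 M1 mf1 gf1 ex1.
  exists (fun j => 4 * fine (dyad mu p (maxfun_c rho mu f0) (j - 1))).
  exists (fun j => 4 * fine (dyad mu p (maxfun_c rho mu f1) (j - 1))).
  split=> [j|j|j||M M_ge0 aM].
  - by rewrite mulr_ge0// fine_ge0.
  - by rewrite mulr_ge0// fine_ge0.
  - have Mle x : (`|maxfun_c rho mu f x| <=
        `|maxfun_c rho mu f0 x| + `|maxfun_c rho mu f1 x|)%E.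
      by rewrite !gee0_abs ?maxfun_c_ge0//; exact: maxfun_c_subadditive.
    apply: le_trans (dyad_quasi_additive mu j p1 Mle) _.
    by rewrite -mulrDr -[in leLHS](fineK (fin0 _)) -[in leLHS](fineK (fin1 _)) -EFinD -EFinM.
  - exact: bnd0.
  - apply: bnd1 => //; move: aM; congr (lq_bounded _ _ _).
    by apply/funext => k; rewrite if_neg.
(* A decomposition at any one height bounds the dyadic values of M f by reals; s = 1 is an arbitrary
   choice. *)
have finM j : dyad mu p (maxfun_c rho mu f) j \is a fin_num.
  have [b0 [b1 [_ _ /(_ j) Mj _ _]]] := dec 1 ltr01.
  by rewrite ge0_fin_numE// (le_lt_trans Mj)// ltry.
exists (fun j => fine (dyad mu p (maxfun_c rho mu f) j)); split=> [j|j|].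
- by rewrite fine_ge0.
- by rewrite fineK.
rewrite mulrC; apply: (lq_marcinkiewicz (r0 := r0) (r1 := r1) (a := a)) => //.
- by rewrite mulr_gt0.
- by move=> j; rewrite fine_ge0.
move=> s s0; have [b0 [b1 [b00 b10 Mb c0 c1]]] := dec s s0.
by exists b0, b1; split=> // j; rewrite -lee_fin fineK.
Qed.

Lemma maxfun_lq_bounded_le (R : realType) (d : measure_display) (T : measurableType d)
    (rho : T -> T -> R) (mu : {measure set T -> \bar R}) (p : R) (q r : \bar R) (C C' : R) :
  (1 <= r)%E -> 0 <= C <= C' ->
  maxfun_lq_bounded rho mu p q r C -> maxfun_lq_bounded rho mu p q r C'.
Proof.
move=> r1 /andP[C0 CC'] HC f mf N N0 fN; have [a [a0 Ma aN]] := HC f mf N N0 fN.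
exists a; split=> //; apply: lq_bounded_le aN => //.
by rewrite mulr_ge0//= ler_wpM2r.
Qed.

Lemma maxfun_bounded_embedding (R : realType) (d : measure_display) (T : measurableType d)
    (rho : T -> T -> R) (mu : {measure set T -> \bar R}) (p : R) (q q' r r' : \bar R) :
  1 <= p -> (1 <= q')%E -> (q' <= q)%E -> (1 <= r)%E -> (r <= r')%E ->
  maxfun_bounded rho mu p q r -> maxfun_bounded rho mu p q' r'.
Proof.
move=> p1 q'1 q'q r1 rr' /(maxfun_bounded_lq p1 (le_trans q'1 q'q) r1)[C C0 HC].
apply: (maxfun_lq_bounded_lorentz p1 q'1 (le_trans r1 rr') C0) => f mf N N0 fN.
apply: bounded_by_lq_le rr' _ _ => //; first by rewrite mulr_ge0// ltW.
apply: HC => //; first exact: ltW.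
by apply: bounded_by_lq_le q'q _ fN => //; exact: ltW.
Qed.

(** * Reciprocal exponents and the conclusion *)

Lemma einv_itv (R : realType) (q : \bar R) : (1 <= q)%E -> 0 <= einv q <= 1.
Proof.
case: q => [r| |]//=; last by rewrite lexx ler01.
rewrite lee_fin => r1; have r0 : 0 < r by apply: lt_le_trans r1.
by rewrite invr_ge0 (ltW r0) invf_le1.
Qed.

Lemma le_einv (R : realType) (q r : \bar R) : (1 <= q)%E -> (1 <= r)%E ->
  (einv r <= einv q) = (q <= r)%E.
Proof.
case: q => [q| |]//; case: r => [r| |]//=; rewrite ?lee_fin => q1 r1; last 2 first.
- have r0 : 0 < r by apply: lt_le_trans r1.
  by rewrite leye_eq/= leNgt invr_gt0 r0.
- by rewrite lexx.
- have q0 : 0 < q by apply: lt_le_trans q1.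
  have r0 : 0 < r by apply: lt_le_trans r1.
  by rewrite lef_pV2.
- have q0 : 0 < q by apply: lt_le_trans q1.
  by rewrite leey invr_ge0 ltW.
Qed.

Lemma einv_from_inv (R : realType) (a : R) : einv (from_inv a) = a.
Proof. by rewrite /from_inv; case: eqP => [->//|_] /=; rewrite invrK. Qed.

Lemma from_inv_ge1 (R : realType) (a : R) : 0 <= a <= 1 -> (1 <= from_inv a)%E.
Proof.
move=> /andP[a0 a1]; rewrite /from_inv; case: eqP => [_|/eqP an0]; first exact: leey.
by rewrite lee_fin invf_ge1// lt0r an0.
Qed.

Lemma einvK (R : realType) (q : \bar R) : 0 < einv q -> q = ((einv q)^-1)%:E.
Proof. by case: q => [r| |]//=; rewrite ?ltxx// invrK. Qed.

Theorem theorem4p4p12 (R : realType) (d : measure_display) (T : measurableType d)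
  (rho : T -> T -> R) (mu : {measure set T -> \bar R})
  (p : R) (q0 q1 r0 r1 : \bar R) :
  inhabited T ->
  is_metric rho ->
  (@measurable d T = <<s metric_open rho >>) ->
  1 <= p ->
  (1 <= q0)%E -> (1 <= q1)%E -> (1 <= r0)%E -> (1 <= r1)%E ->
  (q0 <= q1)%E -> (q0 <= r0)%E -> (q1 <= r1)%E ->
  maxfun_bounded rho mu p q0 r0 ->
  maxfun_bounded rho mu p q1 r1 ->
  forall theta : R, 0 < theta < 1 ->
    maxfun_bounded rho mu p (interp_exp q0 q1 theta) (interp_exp r0 r1 theta).
Proof.
move=> _ met Tmet p1 q01 q11 r01 r11 q0q1 q0r0 q1r1 B0 B1 theta /andP[t0 t1].
have mB := mball_measurable met Tmet.
have /andP[x0_ge0 x0_le1] := einv_itv q01; have /andP[x1_ge0 x1_le1] := einv_itv q11.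
have /andP[u0_ge0 u0_le1] := einv_itv r01; have /andP[u1_ge0 u1_le1] := einv_itv r11.
have x10 : einv q1 <= einv q0 by rewrite le_einv.
pose x := (1 - theta) * einv q0 + theta * einv q1.
pose u := (1 - theta) * einv r0 + theta * einv r1.
have x_itv : 0 <= x <= 1 by rewrite /x; apply/andP; split; nra.
have u_itv : 0 <= u <= 1 by rewrite /u; apply/andP; split; nra.
have qt1 : (1 <= interp_exp q0 q1 theta)%E by exact: from_inv_ge1.
have rt1 : (1 <= interp_exp r0 r1 theta)%E by exact: from_inv_ge1.
(* If r1 <= r0, then q_theta <= q1 and r1 <= r_theta, so the second endpoint suffices. *)
have [u01|u10] := leP (einv r0) (einv r1).
  apply: maxfun_bounded_embedding B1 => //; rewrite -le_einv// einv_from_inv.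
    by rewrite -/x /x; nra.
  by rewrite -/u /u; nra.
(* If q0 = q1, then q_theta = q0, and r0 < r1 gives r0 <= r_theta, so the first endpoint
   suffices. *)
move: x10; rewrite le_eqVlt => /predU1P[x10|x10].
  apply: maxfun_bounded_embedding B0 => //; rewrite -le_einv// einv_from_inv.
    by rewrite -/x /x x10; nra.
  by rewrite -/u /u; nra.
have x0_gt0 : 0 < einv q0 by exact: le_lt_trans x10.
have u0_gt0 : 0 < einv r0 by exact: le_lt_trans u10.
have x_gt0 : 0 < x by rewrite /x; nra.
have u_gt0 : 0 < u by rewrite /u; nra.
have x0x : x < einv q0 by rewrite /x; nra.
have xx1 : einv q1 < x by rewrite /x; nra.
(* A positive reciprocal makes q0 and r0 finite; q1 and r1 may still be infinite. *)
have q0E := einvK x0_gt0; have r0E := einvK u0_gt0.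
have qtE : interp_exp q0 q1 theta = x^-1%:E by rewrite /interp_exp /from_inv -/x gt_eqF.
have rtE : interp_exp r0 r1 theta = u^-1%:E by rewrite /interp_exp /from_inv -/u gt_eqF.
have [C0 C0_gt0 HC0] := maxfun_bounded_lq p1 q01 r01 B0.
have [C1 C1_gt0 HC1] := maxfun_bounded_lq p1 q11 r11 B1.
have C_gt0 : 0 < C0 + C1 by exact: addr_gt0.
have {}HC0 : maxfun_lq_bounded rho mu p q0 r0 (C0 + C1).
  by apply: maxfun_lq_bounded_le HC0 => //; rewrite ltW//= lerDl ltW.
have {}HC1 : maxfun_lq_bounded rho mu p q1 r1 (C0 + C1).
  by apply: maxfun_lq_bounded_le HC1 => //; rewrite ltW//= lerDr ltW.
(* The differences u - 1/ri and x - 1/qi are the same multiple, -theta or 1 - theta, of 1/r0 - 1/r1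
   and 1/q0 - 1/q1. Both balance equations thus reduce to one linear equation for eta, solved here;
   eta > 0 because q0 < q1 and r0 < r1. *)
pose eta := (einv q0 - einv q1) * u / ((einv r0 - einv r1) * x).
have eta0 : 0 < eta by rewrite divr_gt0// mulr_gt0// subr_gt0.
have du : einv r0 - einv r1 != 0 by rewrite subr_eq0 gt_eqF.
have xn0 : x != 0 by rewrite gt_eqF.
have un0 : u != 0 by rewrite gt_eqF.
have frac (v a : R) : v != 0 -> 1 - v^-1 * a = (v - a) / v.
  by move=> v0; rewrite mulrBl divff// [v^-1 * _]mulrC.
have etaE (c : R) : eta * (c * (einv r0 - einv r1) / u) = c * (einv q0 - einv q1) / x.
  by rewrite /eta; move: du xn0 un0; clear; move: x u => x u *; field; apply/and3P.
have Heta0 : eta * (1 - u^-1 / (einv r0)^-1) = 1 - x^-1 / (einv q0)^-1.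
  rewrite !invrK !frac//.
  have -> : u - einv r0 = - theta * (einv r0 - einv r1) by rewrite /u; ring.
  have -> : x - einv q0 = - theta * (einv q0 - einv q1) by rewrite /x; ring.
  exact: etaE.
have Heta1 : eta * (1 - u^-1 * einv r1) = 1 - x^-1 * einv q1.
  rewrite !frac//.
  have -> : u - einv r1 = (1 - theta) * (einv r0 - einv r1) by rewrite /u; ring.
  have -> : x - einv q1 = (1 - theta) * (einv q0 - einv q1) by rewrite /x; ring.
  exact: etaE.
have K0 : 0 <= marcinkiewicz_const (einv q0)^-1 q1 x^-1 u^-1 eta (16 * (C0 + C1)).
  exact: marcinkiewicz_const_ge0.
(* Adding 1 turns a nonnegative constant into a positive one. *)
apply: (maxfun_lq_bounded_lorentz (C := marcinkiewicz_const (einv q0)^-1 q1 x^-1 u^-1 eta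
  (16 * (C0 + C1)) + 1)) => //; first by rewrite ltr_wpDl.
move=> f mf N N0; rewrite qtE rtE => fN.
have : bounded_by_lq u^-1%:E (dyad mu p (maxfun_c rho mu f))
    (marcinkiewicz_const (einv q0)^-1 q1 x^-1 u^-1 eta (16 * (C0 + C1)) * N).
  apply: (@maxfun_lq_interpolation _ _ _ rho mu p (einv q0)^-1 (einv r0)^-1 _ _ _ _ q1 r1) => //.
  - by rewrite -lee_fin -q0E.
  - by rewrite -lee_fin -q0E -r0E.
  - by rewrite ltf_pV2.
  - by rewrite ltNge -le_einv ?lee_fin -?ltNge//= ?invrK//; rewrite -lee_fin -qtE.
  - by rewrite -lee_fin -rtE.
  - by rewrite -q0E -r0E.
move=> [a [a0 Ma aN]]; exists a; split=> //; apply: lq_bounded_le aN => //.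
  by rewrite -rtE.
by rewrite mulr_ge0 ?(ltW N0)//= ler_wpM2r ?(ltW N0)// lerDl ler01.
Qed.
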